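(* Let $H^{321}:\mathcal D\to[0,\infty]$ be defined by $$H^{321}(\pi_1,\pi_2):=\int_0^1\big(\rho_1\log\rho_1+(1-\rho_1)\log(1-\rho_1)+\rho_2\log\rho_2+(1-\rho_2)\log(1-\rho_2)+2\log2\big)\,\mathrm d\mathrm{Leb},$$ where $\rho_1$ and $\rho_2$ are the densities of $\pi_1$ and $\pi_2$ with respect to the Lebesgue measure. For all $n\ge1$, let $\sigma_{n,321}$ be a random permutation chosen uniformly among $321$-avoiding permutations of size $n$. Then the associated pairs of measures $\big(\pi_1^{\sigma_{n,321}},\pi_2^{\sigma_{n,321}}\big)$ satisfy a large deviation principle on $\mathcal D$ at speed $n$ with rate function $H^{321}$.
   Context: $\mathcal M([0,1])$ is the space of finite Borel measures on $[0,1]$ with the topology of weak convergence; $\pi\le\mathrm{Leb}$ means $\pi(A)\le\mathrm{Leb}(A)$ for every Borel $A\subseteq[0,1]$. Define $$\mathcal D:=\left\{(\pi_1,\pi_2)\in\mathcal M([0,1])^2:\ \pi_1\le\mathrm{Leb},\ \pi_2\le\mathrm{Leb},\ \pi_1([0,1])=\pi_2([0,1]),\ \forall x\in[0,1],\ \pi_1([0,x])\le\pi_2([0,x])\right\},$$ with the product weak topology. Convention $0\log0=0$. A permutation is $321$-avoiding if it has no decreasing subsequence of length $3$. A strict right-to-left minimum of a permutation $\sigma$ of size $n$ is a pair $(a,b)$ with $b=\sigma(a)<a$ and $\sigma(c)>b$ for all $c>a$. If $(a_1,b_1),\dots,(a_k,b_k)$ are the strict right-to-left minima of a $321$-avoiding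 permutation $\sigma$ of size $n$ (in increasing order), set $$\pi_1^\sigma:=\sum_{j=1}^k\mathrm{Leb}_{[\frac{a_j-1}n,\frac{a_j}n]},\qquad\pi_2^\sigma:=\sum_{j=1}^k\mathrm{Leb}_{[\frac{b_j-1}n,\frac{b_j}n]},$$ where $\mathrm{Leb}_{I}$ is Lebesgue measure restricted to $I$. Then $(\pi_1^\sigma,\pi_2^\sigma)\in\mathcal D$. A sequence $(X_n)$ of random variables in a Polish space $E$ satisfies a large deviation principle at speed $a_n\to\infty$ with rate function $I:E\to[0,\infty]$ (lower semicontinuous) if $\limsup_n\frac1{a_n}\log\mathbb P(X_n\in F)\le-\inf_FI$ for every closed $F\subseteq E$ and $\liminf_n\frac1{a_n}\log\mathbb P(X_n\in O)\ge-\inf_OI$ for every open $O\subseteq E$. *)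

(* Defs.v *)
From HB Require Import structures.
From mathcomp Require Import all_boot all_order all_algebra all_fingroup.
From mathcomp Require Import all_classical all_reals all_analysis.
Set Implicit Arguments.
Unset Strict Implicit.
Unset Printing Implicit Defensive.
Import Order.TTheory GRing.Theory Num.Theory.
Import numFieldNormedType.Exports.
Local Open Scope classical_set_scope.
Local Open Scope ring_scope.

(* Borel measures on [0,1] are identified with Borel measures on R that vanish
   outside [0,1]. Library measures also take (meaningless) values on
   non-measurable sets: two of them that agree on Borel sets are topologically
   indistinguishable points below. *)
Record unit_measure (R : realType) := UnitMeasure {
  unit_measure_val :>
    {finite_measure set (measurableTypeR R) -> \bar R};
  unit_measure_carried : unit_measure_val (~` `[0, 1]%classic) = 0%E }.

Section unit_measure_topology.
Variable R : realType.

Definition test_fun := {f : R -> R | {within `[0, 1], continuous f}}.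

Definition unit_measure_eval (mu : unit_measure R) : {ptws test_fun -> R} :=
  fun f => (\int[mu]_(x in `[0, 1]) sval f x)%R.

HB.instance Definition _ := gen_eqMixin (unit_measure R).
HB.instance Definition _ := gen_choiceMixin (unit_measure R).

(* Weak convergence: the coarsest topology for which every map
   mu |-> \int f dmu, with f continuous on [0,1], is continuous. *)
HB.instance Definition _ := Topological.copy (unit_measure R)
  (initial_topology unit_measure_eval).

End unit_measure_topology.

Section domain.
Variable R : realType.

Definition le_leb (mu : unit_measure R) : Prop :=
  forall A : set (measurableTypeR R), measurable A -> A `<=` `[0, 1] ->
    (mu A <= lebesgue_measure A)%E.

Definition calD : set (unit_measure R * unit_measure R) :=
  [set p | [/\ le_leb p.1, le_leb p.2,
    p.1 `[0, 1]%classic = p.2 `[0, 1]%classic &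
    forall x : R, x \in `[0, 1] ->
      (p.1 `[0%R, x]%classic <= p.2 `[0%R, x]%classic)%E]].

Definition density (mu : unit_measure R) (x : R) : R :=
  fine (Radon_Nikodym (charge_of_finite_measure mu) lebesgue_measure x).

(* [ln 0 = 0], hence [xlnx 0 = 0]. *)
Definition xlnx (x : R) : R := x * ln x.

Definition H321 (p : calD) : \bar R :=
  let rho1 := density (val p).1 in
  let rho2 := density (val p).2 in
  (\int[lebesgue_measure]_(x in `[0%R, 1%R])
    (xlnx (rho1 x) + xlnx (1 - rho1 x) + xlnx (rho2 x) + xlnx (1 - rho2 x)
     + 2 * ln 2)%:E)%E.

End domain.

Section permutation_measures.
Variables (R : realType) (n : nat).

Definition block (k : 'I_n) : set (measurableTypeR R) :=
  `[k%:R / n%:R, k.+1%:R / n%:R]%classic.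

Lemma measurable_block k : measurable (block k).
Proof. exact: measurable_itv. Qed.

Definition block_sum (s : seq 'I_n) (A : set (measurableTypeR R)) : \bar R :=
  (\sum_(k <- s) mrestr lebesgue_measure (measurable_block k) A)%E.

Lemma block_sumE (s : seq 'I_n) : block_sum s =
  msum (fun j => mrestr lebesgue_measure
    (measurable_itv `[(nth 0%N (map val s) j)%:R / n%:R : R,
       (nth 0%N (map val s) j).+1%:R / n%:R])) (size s).
Proof.
apply/funext => A; rewrite /block_sum /msum.
case: s => [|k0 s]; first by rewrite big_nil big_ord0.
rewrite (big_nth k0) big_mkord; apply: eq_bigr => i _.
by rewrite /mrestr /block (nth_map k0).
Qed.

Lemma block_sum0 s : block_sum s set0 = 0%E.
Proof. by rewrite block_sumE measure0. Qed.

Lemma block_sum_ge0 s A : (0 <= block_sum s A)%E.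
Proof. by rewrite block_sumE measure_ge0. Qed.

Lemma block_sum_sigma_additive s : semi_sigma_additive (block_sum s).
Proof. by rewrite block_sumE; exact: measure_semi_sigma_additive. Qed.

HB.instance Definition _ s := isMeasure.Build _ _ _ (block_sum s)
  (block_sum0 s) (block_sum_ge0 s) (@block_sum_sigma_additive s).

Lemma natr_gt0_ord (k : 'I_n) : 0 < n%:R :> R.
Proof. by rewrite ltr0n; apply: leq_ltn_trans (ltn_ord k). Qed.

Lemma lebesgue_block k : lebesgue_measure (block k) = (n%:R^-1)%:E.
Proof.
have n0 := natr_gt0_ord k.
rewrite /block lebesgue_measure_itv /= lte_fin ltr_pM2r ?invr_gt0//.
by rewrite ltr_nat ltnSn -EFinD -mulrBl -natrB// subSnn mul1r.
Qed.

Lemma sub_block k : block k `<=` `[0, 1]%classic.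
Proof.
have n0 := natr_gt0_ord k.
move=> x; rewrite /block /= !in_itv /= => /andP[h1 h2]; apply/andP; split.
  by apply: le_trans h1; rewrite divr_ge0.
by apply: (le_trans h2); rewrite ler_pdivrMr// mul1r ler_nat.
Qed.

Lemma block_sum_fin s : fin_num_fun (block_sum s).
Proof.
apply: lty_fin_num_fun; rewrite /block_sum; apply: lte_sum_pinfty => k _.
by rewrite /mrestr setTI [ltLHS]lebesgue_block ltry.
Qed.

HB.instance Definition _ s := Measure_isFinite.Build _ _ _ (block_sum s)
  (block_sum_fin s).

Lemma block_sum_carried s : block_sum s (~` `[0, 1]%classic) = 0%E.
Proof.
rewrite /block_sum big1// => k _; rewrite /mrestr.
rewrite (_ : _ `&` _ = set0) ?measure0//.
by apply/seteqP; split=> x //= [+ /sub_block].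
Qed.

Definition block_measure (s : seq 'I_n) : unit_measure R :=
  UnitMeasure (block_sum_carried s).

Lemma block_measure_le s : uniq s -> le_leb (block_measure s).
Proof.
move=> us A mA _; rewrite /= /block_sum.
pose hblock (k : 'I_n) : set (measurableTypeR R) :=
  `[k%:R / n%:R, k.+1%:R / n%:R[%classic.
have mh k : measurable (hblock k) by exact: measurable_itv.
have -> : (\sum_(k <- s) mrestr lebesgue_measure (measurable_block k) A =
           \sum_(k <- s) lebesgue_measure (A `&` hblock k))%E.
  apply: eq_bigr => k _; rewrite /mrestr; apply/eqP; rewrite eq_le.
  apply/andP; split; last first.
    apply: le_measure; rewrite ?inE; [exact: measurableI| |].
      exact: measurableI (measurable_block k).
    apply: setIS => x; rewrite /hblock /block /= !in_itv /=.
    by move=> /andP[-> /ltW ->].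
  have m1 : measurable [set k.+1%:R / n%:R : measurableTypeR R].
    exact: measurable_set1.
  apply: (@le_trans _ _ (lebesgue_measure
      ((A `&` hblock k) `|` [set k.+1%:R / n%:R : measurableTypeR R]))).
    apply: le_measure; rewrite ?inE.
    - exact: measurableI (measurable_block k).
    - by apply: measurableU => //; exact: measurableI.
    - move=> x [Ax]; rewrite /block /hblock /= !in_itv /= => /andP[h1].
      by rewrite le_eqVlt => /orP[/eqP ->|h2]; [right|left; rewrite h1].
  apply: le_trans (measureU2 _ _ _) _ => //; first exact: measurableI.
  by rewrite [X in (_ + X)%E](lebesgue_measure_set1 _) adde0.
rewrite big_uniq//= -measure_bigsetU_ord_cond.
- apply: le_measure; rewrite ?inE//.
    by apply: bigsetU_measurable => k _; exact: measurableI.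
  by apply: (big_ind (fun B => B `<=` A)) => // B C BA CA x [/BA|/CA].
- by move=> k _; exact: measurableI.
- move=> k l _ _ [x [[_ +] [_ +]]]; rewrite /hblock /= !in_itv /=.
  move=> /andP[k1 k2] /andP[l1 l2]; apply/val_inj/eqP.
  have n0 := natr_gt0_ord k.
  have := le_lt_trans k1 l2; have := le_lt_trans l1 k2.
  by rewrite !ltr_pM2r ?invr_gt0// !ltr_nat !ltnS eqn_leq => -> ->.
Qed.

Lemma block_measure_mass s :
  block_measure s `[0, 1]%classic = ((size s)%:R / n%:R)%:E.
Proof.
rewrite /= /block_sum.
rewrite (eq_bigr (fun=> (n%:R^-1)%:E)) => [|k _]; last first.
  by rewrite /mrestr (setIidr (@sub_block k)) [LHS]lebesgue_block.
rewrite sumEFin; congr EFin.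
by rewrite big_const_seq count_predT iter_addr_0 mulr_natl.
Qed.

(* Indices range over {0, ..., n-1}, so [(a, b)] stands for the pair
   [(a + 1, b + 1)] and [block a] is the interval [(a+1-1)/n, (a+1)/n]. *)
Definition strict_rlmin (s : 'S_n) (p : 'I_n * 'I_n) : bool :=
  [&& p.2 == s p.1, (p.2 < p.1)%N &
      [forall c : 'I_n, (p.1 < c)%N ==> (p.2 < s c)%N]].

Definition strict_rlmins (s : 'S_n) : seq ('I_n * 'I_n) :=
  [seq p <- [seq (a, s a) | a <- enum 'I_n] | strict_rlmin s p].

Definition pi1 (s : 'S_n) : unit_measure R :=
  block_measure [seq p.1 | p <- strict_rlmins s].
Definition pi2 (s : 'S_n) : unit_measure R :=
  block_measure [seq p.2 | p <- strict_rlmins s].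

Lemma strict_rlminsP s p :
  p \in strict_rlmins s -> p.2 = s p.1 /\ (p.2 < p.1)%N.
Proof. by rewrite mem_filter => /andP[/and3P[/eqP -> ? _] _]. Qed.

Lemma uniq_strict_rlmins s : uniq (strict_rlmins s).
Proof.
by rewrite filter_uniq// map_inj_uniq ?enum_uniq// => a b [].
Qed.

Lemma block_lt (k l : 'I_n) (x : R) : (l < k)%N ->
  (lebesgue_measure (`[0%R, x] `&` block k) <=
   lebesgue_measure (`[0%R, x] `&` block l))%E.
Proof.
move=> lk; have n0 := natr_gt0_ord k; have [xl|lx] := ltP x (l.+1%:R / n%:R).
  rewrite (_ : `[0%R, x] `&` block k = set0) ?measure0//.
  apply/seteqP; split => y //= [] /=; rewrite /block /= !in_itv /=.
  move=> /andP[_ yx] /andP[ky _].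
  have := le_lt_trans ky (le_lt_trans yx xl).
  by rewrite ltr_pM2r ?invr_gt0// ltr_nat ltnNge lk.
rewrite [X in (_ <= lebesgue_measure X)%E](_ : _ = block l).
  rewrite [leRHS]lebesgue_block -(lebesgue_block k); apply: le_measure.
  - rewrite inE; apply: measurableI; first exact: measurable_itv.
    exact: measurable_block.
  - by rewrite inE; exact: measurable_block.
  - by move=> y [].
apply/seteqP; split => y; first by case.
move=> yl; split => //; move: (sub_block yl) (yl).
rewrite /block /= !in_itv /= => /andP[-> _] /andP[_ yl2].
exact: le_trans lx.
Qed.

Lemma pi_pair_calD (s : 'S_n) : (pi1 s, pi2 s) \in @calD R.
Proof.
rewrite inE; split => /=.
- apply: block_measure_le; rewrite map_inj_in_uniq ?uniq_strict_rlmins// => p q.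
  move=> /strict_rlminsP[p2 _] /strict_rlminsP[q2 _].
  by case: p q p2 q2 => [p1 p2] [q1 q2] /= -> -> ->.
- apply: block_measure_le; rewrite map_inj_in_uniq ?uniq_strict_rlmins// => p q.
  move=> /strict_rlminsP[p2 _] /strict_rlminsP[q2 _].
  case: p q p2 q2 => [p1 p2] [q1 q2] /= -> -> /perm_inj.
  by move=> ->.
- by rewrite !block_measure_mass !size_map.
- move=> x _; rewrite /block_sum !big_map !big_seq.
  apply: lee_sum => p /strict_rlminsP[_ p21].
  exact: block_lt.
Qed.

Definition pi_pair (s : 'S_n) : @calD R := SigSub (pi_pair_calD s).

End permutation_measures.

Definition avoids321 (n : nat) (s : 'S_n) : bool :=
  ~~ [exists i : 'I_n, exists j : 'I_n, exists k : 'I_n,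
       [&& (i < j)%N, (j < k)%N, (s j < s i)%N & (s k < s j)%N]].

Definition Av321 (n : nat) : {set 'S_n} := [set s | avoids321 s]%SET.

Definition uniform_on (R : realType) (d : measure_display)
    (Omega : measurableType d) (P : probability Omega R) (T : finType)
    (X : Omega -> T) (A : {set T}) : Prop :=
  forall t : T, measurable (X @^-1` [set t]) /\
    P (X @^-1` [set t]) = (if t \in A then #|A|%:R^-1 else 0)%:E.

Section ldp.
Variables (R : realType) (E : topologicalType).

(* [X] is a sequence of random elements of [E] with its Borel sigma-algebra,
   the n-th one being defined on its own probability space. *)
Definition ldp (d : nat -> measure_display)
    (Omega : forall n, measurableType (d n))
    (P : forall n, probability (Omega n) R) (X : forall n, Omega n -> E)
    (a : nat -> R) (I : E -> \bar R) : Prop :=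
  [/\ forall n (B : set E), <<s @open E >> B -> measurable (X n @^-1` B),
      a @ \oo --> +oo,
      (forall x, (0 <= I x)%E) /\ lower_semicontinuous I,
      forall F : set E, closed F ->
        (limn_esup (fun n => (a n)^-1%:E * lne (P n (X n @^-1` F)))
           <= - ereal_inf (I @` F))%E &
      forall O : set E, open O ->
        (- ereal_inf (I @` O)
           <= limn_einf (fun n => (a n)^-1%:E * lne (P n (X n @^-1` O))))%E].

End ldp.

(* Main.v *)
From HB Require Import structures.
Require Import Defs.
From mathcomp Require Import all_boot all_order all_algebra all_fingroup.
From mathcomp Require Import all_classical all_reals all_analysis.
From mathcomp Require Import measurable_realfun ring lra zify.
Set Implicit Arguments.
Unset Strict Implicit.
Unset Printing Implicit Defensive.
Import Order.TTheory GRing.Theory Num.Theory.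
Import numFieldNormedType.Exports.
Local Open Scope classical_set_scope.
Local Open Scope ring_scope.

(** Why the theorem is true.

    In a 321-avoiding permutation s, the positions of the strict right-to-left
    minima are exactly the positions a with [s a < a], and s is increasing
    both on the set A of these positions and on its complement. So s is
    determined by A together with the set B of the values taken on A
    ([Av321_inj]). Conversely a pair (A, B) of sets of the same size arises in
    this way if, for every k, A has no more elements up to k than B has strictly
    below k ([exists_Av321]).
    Hence the number of 321-avoiding permutations is 4 ^ n up to a
    subexponential factor, and A and B behave like two independent uniformly
    random sets, up to a constraint that becomes the ordering of the two
    distribution functions in the domain. With [entropy] the binary entropy,
    the rate function is 2 ln 2 minus the integrals of the entropies of the
    two densities ([H321_meanent]).

    Upper bound. The entropy is the convex dual of
    phi f = ln (1 + exp f), that is, entropy r = inf_f (phi f - r f). After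
    integration, H321 is the supremum over pairs of continuous functions of
      Psi f g (p1, p2) = 2 ln 2 + int f dp1 - int phi(f) dx
                                + int g dp2 - int phi(g) dx
    ([Psi_le], [Psi_approx]). Each [Psi f g] is continuous, which gives the
    lower semicontinuity of H321. By Chernoff's bound, at most
    exp (n (2 ln 2 - a)) permutations satisfy [a <= Psi f g]: the exponential
    moment, summed over all pairs of sets, factorises over the points, and
    Jensen's inequality for phi on each block of length 1 / n compares it to
    the integrals of phi(f) and phi(g) ([card_Psi_le]). The domain is compact
    ([compact_calD]), so that a closed set on which H321 exceeds a is covered
    by finitely many of the sets where [a < Psi f g] ([count_closed_le]).

    Lower bound. Weak convergence in the domain follows from the pointwise
    convergence of distribution functions ([cvg_calD]), so a neighborhood of
    (p1, p2) contains every pair whose distribution functions are uniformly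
    close to those G1, G2 of p1, p2. The indices are cut into m + 1 layers of
    length L, and the number of points of A and B in each layer is prescribed
    by the increments of G1 and G2; shifting A by one layer to the right makes
    the pair admissible ([layers_Av321]). The number of choices is a product
    of binomial coefficients, of logarithm about L times the sum of the
    entropies of the mean densities on the cells of length 1 / m. By Jensen's
    inequality, now for the concave function [entropy], this is at least
    m L times the sum of the integrals of the entropies of the two densities
    ([close_to_eventually], [meanent_le_entropy_sum]).

    The same two bounds, with f = g = 0 and with both densities equal to 1/2,
    estimate the total number of 321-avoiding permutations, and the
    probabilities are quotients of two cardinals. *)

(** * Binary entropy and its convex dual *)

Section entropy.
Variable R : realType.
Implicit Types (r f e x y : R).

Definition entropy r : R := - (xlnx r + xlnx (1 - r)).
(** At e = 0 this is the f that maximises [r * f - log1pexp f]; taking e > 0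
    keeps it bounded when r approaches 0 or 1. *)
Definition logit e r : R := ln ((r + e) / (1 - r + e)).
(** The logarithmic moment generating function of a random bit, up to the
    additive constant ln 2: the convex dual of [- entropy]. *)
Definition log1pexp f : R := ln (1 + expR f).

Lemma ln_sub1 x : 0 < x -> ln x <= x - 1.
Proof.
move=> x0; have := @le_ln1Dx R (x - 1).
by rewrite (_ : 1 + (x - 1) = x); [apply|]; lra.
Qed.

Lemma xlnx0 : xlnx (0 : R) = 0.
Proof. by rewrite /xlnx mul0r. Qed.

Lemma xlnx1 : xlnx (1 : R) = 0.
Proof. by rewrite /xlnx ln1 mulr0. Qed.

(** The difference of the two sides is the relative entropy of the Bernoulli
    law of parameter r with respect to that of parameter
    [expR f / (1 + expR f)]; it is nonnegative because ln x <= x - 1. *)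
Lemma entropy_le r f : 0 <= r <= 1 -> entropy r <= log1pexp f - r * f.
Proof.
move=> /andP[r0 r1]; rewrite /entropy /log1pexp.
have e0 := expR_gt0 f.
have : 0 <= ln (1 + expR f) by apply: ln_ge0; lra.
have : f <= ln (1 + expR f).
  by rewrite -{1}(expRK f) ler_ln ?posrE; lra.
move: r0 r1; rewrite le_eqVlt => /orP[/eqP<- _ hf h0|r0].
  by rewrite subr0 xlnx0 xlnx1; lra.
rewrite le_eqVlt => /orP[/eqP-> hf h0|r1 _ _].
  by rewrite subrr xlnx0 xlnx1; lra.
set Z := 1 + expR f.
have Z0 : 0 < Z by rewrite /Z; lra.
have q0 : 0 < 1 - r by lra.
have a0 : 0 < r * Z by apply: mulr_gt0.
have b0 : 0 < (1 - r) * Z by apply: mulr_gt0.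
(* [expR f / (r * Z)] and [1 / ((1 - r) * Z)] are the likelihood ratios of the
   two Bernoulli laws. *)
have := ln_sub1 (divr_gt0 e0 a0).
rewrite ln_div ?posrE// lnM ?posrE// expRK => /(ler_wpM2l (ltW r0)).
have := ln_sub1 (divr_gt0 ltr01 b0).
rewrite ln_div ?posrE// lnM ?posrE// ln1 => /(ler_wpM2l (ltW q0)).
have -> : (1 - r) * (1 / ((1 - r) * Z) - 1) = 1 / Z - (1 - r).
  by field; lra.
have -> : r * (expR f / (r * Z) - 1) = (Z - 1) / Z - r.
  rewrite /Z (addrC 1) addrK; field; lra.
have -> : (Z - 1) / Z = 1 - 1 / Z by field; lra.
rewrite /xlnx; nra.
Qed.

(** [logit e r] is almost optimal in [entropy_le]: shifting the arguments of
    the logarithms by e only decreases [- s * ln (s + e)] below [- xlnx s], and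
    the denominators contribute ln (1 + 2 e) <= 2 e. *)
Lemma entropy_ge r e : 0 <= r <= 1 -> 0 < e ->
  log1pexp (logit e r) - r * logit e r <= entropy r + 2 * e.
Proof.
move=> /andP[r0 r1] e0; rewrite /entropy /log1pexp /logit.
have a0 : 0 < r + e by lra.
have b0 : 0 < 1 - r + e by lra.
rewrite lnK ?posrE ?divr_gt0//.
have -> : 1 + (r + e) / (1 - r + e) = (1 + 2 * e) / (1 - r + e).
  by field; lra.
rewrite !ln_div ?posrE//; last lra.
have : ln (1 + 2 * e) <= 2 * e by apply: le_ln1Dx; lra.
have H s : 0 <= s -> xlnx s <= s * ln (s + e).
  rewrite le_eqVlt => /orP[/eqP<-|s0]; first by rewrite xlnx0 mul0r.
  by rewrite /xlnx ler_pM2l// ler_ln ?posrE; lra.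
have := H r r0; have := H (1 - r); rewrite subr_ge0 r1 => /(_ isT).
nra.
Qed.

Lemma entropy_ge0 r : 0 <= r <= 1 -> 0 <= entropy r.
Proof.
move=> /andP[r0 r1]; rewrite /entropy /xlnx.
have : ln r <= 0 by apply: ln_le0.
have : ln (1 - r) <= 0 by apply: ln_le0; lra.
nra.
Qed.

Lemma entropy_le_ln2 r : 0 <= r <= 1 -> entropy r <= ln 2.
Proof. by move=> /(@entropy_le _ 0); rewrite /log1pexp expR0 mulr0 subr0. Qed.

Lemma entropy_half : entropy 2^-1 = ln 2.
Proof.
rewrite /entropy /xlnx (_ : 1 - 2^-1 = 2^-1); last by lra.
by rewrite lnV ?posrE//; lra.
Qed.

Lemma logit_bound r e : 0 <= r <= 1 -> 0 < e ->
  `|logit e r| <= ln ((1 + e) / e).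
Proof.
move=> /andP[r0 r1] e0; rewrite /logit.
have a0 : 0 < r + e by lra.
have b0 : 0 < 1 - r + e by lra.
have mono x y : 0 < x -> x <= y -> ln x <= ln y.
  by move=> x0 xy; rewrite ler_ln ?posrE//; lra.
rewrite !ln_div ?posrE//; last lra.
have /mono : r + e <= 1 + e by lra. move=> /(_ a0).
have /mono : 1 - r + e <= 1 + e by lra. move=> /(_ b0).
have /(mono _ _ e0) : e <= r + e by lra.
have /(mono _ _ e0) : e <= 1 - r + e by lra.
by move=> ? ? ? ?; rewrite ler_norml; apply/andP; split; lra.
Qed.

(** The affine function [r => log1pexp f - r * f] with [f := logit e y]
    dominates the entropy everywhere and exceeds it by at most 2 e at y, and
    its slope is controlled by [logit_bound]. *)
Lemma entropy_modulus r y e : 0 <= r <= 1 -> 0 <= y <= 1 -> 0 < e ->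
  entropy r <= entropy y + 2 * e + `|y - r| * ln ((1 + e) / e).
Proof.
move=> r01 y01 e0.
apply: (le_trans (entropy_le (logit e y) r01)).
have := entropy_ge y01 e0.
have : (y - r) * logit e y <= `|y - r| * ln ((1 + e) / e).
  apply: (le_trans (ler_norm _)); rewrite normrM ler_wpM2l//.
  exact: logit_bound.
lra.
Qed.

(** A crude form of Stirling's formula, here and in [ln_fact_le]: errors of
    order ln n are harmless at speed n, and ln x <= x - 1 gives the induction
    steps. *)
Lemma ln_fact_ge n : xlnx n%:R - n%:R <= ln (n`!%:R : R).
Proof.
elim: n => [|n IH]; first by rewrite fact0 ln1 xlnx0 subr0.
rewrite factS natrM lnM ?posrE ?ltr0n ?fact_gt0//.
case: n IH => [|n] IH.
  by rewrite fact0 ln1 xlnx1; lra.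
move: IH; set N : R := n.+1%:R => IH.
have N0 : 0 < N by rewrite ltr0n.
have E : n.+2%:R = N + 1 :> R by rewrite -natr1.
rewrite E.
have N1 : 0 < N + 1 by lra.
have := ln_sub1 (divr_gt0 N1 N0); rewrite ln_div ?posrE//.
move=> /(ler_wpM2l (ltW N0)).
have -> : N * ((N + 1) / N - 1) = 1 by field; lra.
move: IH; rewrite /xlnx; lra.
Qed.

Lemma ln_fact_le n : ln (n`!%:R : R) <= xlnx n%:R - n%:R + 1 + ln n%:R.
Proof.
elim: n => [|n IH]; first by rewrite fact0 ln1 xlnx0 (@ln0 R)// ; lra.
rewrite factS natrM lnM ?posrE ?ltr0n ?fact_gt0//.
case: n IH => [|n] IH.
  by rewrite fact0 ln1 xlnx1; lra.
move: IH; set N : R := n.+1%:R => IH.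
have N0 : 0 < N by rewrite ltr0n.
have E : n.+2%:R = N + 1 :> R by rewrite -natr1.
have N1 : 0 < N + 1 by lra.
rewrite E.
have := ln_sub1 (divr_gt0 N0 N1); rewrite ln_div ?posrE//.
move=> /(ler_wpM2l (ltW N1)).
have -> : (N + 1) * (N / (N + 1) - 1) = - 1 by field; lra.
move: IH; rewrite /xlnx; lra.
Qed.

Lemma ln_bin_ge n k : (k <= n)%N -> (0 < n)%N ->
  n%:R * entropy (k%:R / n%:R) - 2 - 2 * ln n%:R <= ln ('C(n, k)%:R : R).
Proof.
move=> kn n0; have N0 : 0 < n%:R :> R by rewrite ltr0n.
have := congr1 (fun z : nat => ln (z%:R : R)) (bin_fact kn).
rewrite /= !natrM !lnM ?posrE ?mulr_gt0 ?ltr0n ?fact_gt0 ?bin_gt0//.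
have := ln_fact_ge n; have := ln_fact_le k; have := ln_fact_le (n - k).
have mono j : (j <= n)%N -> ln j%:R <= ln n%:R :> R.
  case: j => [_|j jn]; first by rewrite (@ln0 R)// ln_ge0// ler1n.
  by rewrite ler_ln ?posrE ?ltr0n// ler_nat.
have := mono _ kn; have := mono _ (leq_subr k n).
have -> : n%:R * entropy (k%:R / n%:R : R) =
    xlnx n%:R - xlnx k%:R - xlnx (n - k)%:R.
  have S j : n%:R * xlnx (j%:R / n%:R : R) = xlnx j%:R - j%:R * ln n%:R.
    case: j => [|j]; first by rewrite !mul0r xlnx0 mulr0 subr0.
    rewrite /xlnx ln_div ?posrE ?ltr0n//; field; lra.
  rewrite /entropy mulrN mulrDr.
  have -> : 1 - k%:R / n%:R = (n - k)%:R / n%:R :> R.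
    by rewrite natrB//; field; lra.
  by rewrite !S natrB// /xlnx; lra.
rewrite natrB//; lra.
Qed.

Lemma ln_sublinear_eps (n : nat) e : (0 < n)%N -> 0 < e ->
  ln n%:R <= e * n%:R - ln e.
Proof.
move=> n0 e0; have N0 : 0 < n%:R :> R by rewrite ltr0n.
by have := ln_sub1 (mulr_gt0 e0 N0); rewrite lnM ?posrE//; lra.
Qed.

End entropy.

(** * Densities of measures below Lebesgue measure *)

Section density_facts.
Variable R : realType.
Notation leb := (@lebesgue_measure R).
Notation I01 := (`[0 : R, 1 : R]%classic).
Implicit Types (mu : unit_measure R) (A : set (measurableTypeR R)).

Lemma measurable_I01 : measurable (I01 : set (measurableTypeR R)).
Proof. exact: measurable_itv. Qed.

Lemma leb_I01 : leb I01 = 1%E.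
Proof. by rewrite lebesgue_measure_itv/= lte01 oppr0 adde0. Qed.

Lemma unit_measureI mu A : measurable A -> mu A = mu (A `&` I01).
Proof.
move=> mA; apply/eqP; rewrite eq_le; apply/andP; split; last first.
  apply: le_measure; rewrite ?inE//; exact: measurableI measurable_I01.
rewrite {1}(_ : A = (A `&` I01) `|` (A `&` ~` I01)); last first.
  by rewrite -setIUr setUv setIT.
apply: (le_trans (measureU2 _ _ _)).
- exact: measurableI measurable_I01.
- by apply: measurableI => //; exact: measurableC measurable_I01.
- rewrite -[leRHS]adde0 leeD2l//.
  rewrite -(@unit_measure_carried _ mu); apply: le_measure; rewrite ?inE//.
  + by apply: measurableI => //; exact: measurableC measurable_I01.
  + exact: measurableC measurable_I01.
Qed.

Lemma le_leb_all mu A : le_leb mu -> measurable A -> (mu A <= leb (A `&` I01))%E.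
Proof.
move=> h mA; rewrite unit_measureI//; apply: h; last exact: subIsetr.
exact: measurableI measurable_I01.
Qed.

Lemma le_leb_dominates mu : le_leb mu -> mu `<< leb.
Proof.
move=> h; apply/null_content_dominatesP => A mA A0.
apply/eqP; rewrite eq_le measure_ge0 andbT.
apply: (le_trans (le_leb_all h mA)); rewrite -[leRHS]A0.
apply: le_measure; rewrite ?inE//; exact: measurableI measurable_I01.
Qed.

Lemma RN_integrable mu : le_leb mu -> leb.-integrable setT
  (Radon_Nikodym (charge_of_finite_measure mu) leb).
Proof. by move=> h; apply: Radon_Nikodym_integrable; exact: le_leb_dominates. Qed.

Lemma measurable_density mu : le_leb mu -> measurable_fun setT (density mu).
Proof.
move=> h; have := RN_integrable h => /measurable_int mRN.
exact: measurableT_comp (fine_measurable measurableT) mRN.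
Qed.

Lemma densityE mu x : le_leb mu ->
  (density mu x)%:E = Radon_Nikodym (charge_of_finite_measure mu) leb x.
Proof.
move=> h; rewrite /density fineK//; apply: Radon_Nikodym_fin_num.
exact: le_leb_dominates.
Qed.

Lemma density_integrable mu A : le_leb mu -> measurable A ->
  leb.-integrable A (EFin \o density mu).
Proof.
move=> h mA; apply: (integrableS measurableT) => //.
by have := RN_integrable h; apply: eq_integrable => // x _; rewrite /= densityE.
Qed.

Lemma density_integral mu A : le_leb mu -> measurable A ->
  mu A = (\int[leb]_(x in A) (density mu x)%:E)%E.
Proof.
move=> h mA; have -> : mu A = charge_of_finite_measure mu A by [].
rewrite (@Radon_Nikodym_integral _ _ _ _ leb)//; last exact: le_leb_dominates.
by apply: eq_integral => x _; rewrite densityE.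
Qed.

(** Applied to [- density] and to [density - 1], this shows that a measure
    below Lebesgue measure has its density in [0, 1] almost everywhere. *)
Lemma integral_le_null (f : R -> R) A : measurable A ->
  leb.-integrable A (EFin \o f) -> (forall x, A x -> 0 < f x) ->
  (\int[leb]_(x in A) (f x)%:E <= 0)%E -> leb A = 0%E.
Proof.
move=> mA fi f0 fle.
have mf := measurable_int _ fi.
have : ae_eq leb A (EFin \o f) (cst 0%E).
  apply/ae_eq_integral_abs => //.
  apply/eqP; rewrite eq_le integral_ge0// andbT.
  apply: le_trans fle; rewrite le_eqVlt; apply/orP; left; apply/eqP.
  by apply: eq_integral => x; rewrite inE => /f0 fx; rewrite /= gtr0_norm.
case=> N [mN N0 sN]; apply/eqP; rewrite eq_le measure_ge0 andbT -N0.
apply: le_measure; rewrite ?inE// => x Ax; apply: sN => /= /(_ Ax) [] e.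
by have := f0 _ Ax; rewrite e ltxx.
Qed.

Lemma density_ge0_ae mu : le_leb mu -> leb [set x | density mu x < 0] = 0%E.
Proof.
move=> h; set A := [set x | _].
have mA : measurable (A : set (measurableTypeR R)).
  have -> : A = setT `&` (density mu) @^-1` `]-oo, 0[.
    by apply/seteqP; split=> x /=; rewrite ?in_itv//= => -[].
  exact: measurable_density.
apply: (@integral_le_null (fun x => - density mu x)) => //.
- rewrite (_ : EFin \o _ = \- (EFin \o density mu))%E; last by apply/funext.
  by apply: integrableN; exact: density_integrable.
- by move=> x /=; rewrite /A /= oppr_gt0.
- under eq_integral do rewrite EFinN.
  rewrite integralN; last first.
    have := density_integrable h mA; exact: integrable_add_def.
  by rewrite -density_integral// oppe_le0.
Qed.

Lemma density_le1_ae mu : le_leb mu ->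
  leb (I01 `&` [set x | 1 < density mu x]) = 0%E.
Proof.
move=> h; set A := _ `&` _.
have mA : measurable (A : set (measurableTypeR R)).
  have -> : A = I01 `&` (density mu) @^-1` `]1, +oo[.
    by apply/seteqP; split=> x /=; rewrite !in_itv/= !andbT.
  apply: measurable_funTS; last exact: measurable_itv.
    exact: measurable_density.
  exact: measurable_I01.
have fA : (leb A < +oo)%E.
  apply: (@le_lt_trans _ _ (leb I01)); last by rewrite leb_I01 ltry.
  by apply: le_measure; rewrite ?inE// => x [].
have i1 : leb.-integrable A (EFin \o cst 1).
  by apply: measurable_bounded_integrable => //; exists 1; split=> // y y1 x _; rewrite /= normr1; exact: ltW.
apply: (@integral_le_null (fun x => density mu x - 1)) => //.
- rewrite (_ : EFin \o _ = (EFin \o density mu) \- (EFin \o cst 1%R))%E;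
    last by apply/funext.
  by apply: integrableB => //; exact: density_integrable.
- by move=> x /= [_]/=; rewrite subr_gt0.
- under eq_integral do rewrite EFinB.
  have di := density_integrable h mA.
  rewrite (integralB_EFin mA di i1) -density_integral//.
  have -> : (\int[leb]_(x in A) (cst 1 x)%:E = leb A)%E.
    by rewrite -[RHS]mul1e -integral_cst.
  by rewrite sube_le0; apply: h => // x [].
Qed.

(** Within [0, 1], truncation modifies the density on a null set only
    ([dens_ae]), and it provides bounds that hold at every point. *)
Definition dens mu x : R := Num.max 0 (Num.min 1 (density mu x)).

Lemma dens01 mu x : 0 <= dens mu x <= 1.
Proof. by rewrite /dens le_max lexx /= ge_max ler01 /= ge_min lexx. Qed.

Lemma measurable_dens mu : le_leb mu -> measurable_fun setT (dens mu).
Proof.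
move=> h; apply: measurable_maxr => //; apply: measurable_minr => //.
exact: measurable_density.
Qed.

Lemma dens_ae mu : le_leb mu -> ae_eq leb I01 (density mu) (dens mu).
Proof.
move=> h; exists ([set x | density mu x < 0] `|` (I01 `&` [set x | 1 < density mu x])).
have m1 : measurable ([set x | density mu x < 0] : set (measurableTypeR R)).
  have -> : [set x | density mu x < 0] = setT `&` (density mu) @^-1` `]-oo, 0[.
    by apply/seteqP; split=> x /=; rewrite ?in_itv//= => -[].
  exact: measurable_density.
have m2 : measurable (I01 `&` [set x | 1 < density mu x] : set (measurableTypeR R)).
  have -> : I01 `&` [set x | 1 < density mu x] =
      I01 `&` (density mu) @^-1` `]1, +oo[.
    by apply/seteqP; split=> x /=; rewrite !in_itv/= !andbT.
  apply: measurable_funTS; last exact: measurable_itv.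
    exact: measurable_density.
  exact: measurable_I01.
split; first exact: measurableU.
- by rewrite measureU0//; [exact: density_ge0_ae|exact: density_le1_ae].
- move=> x /=; apply: contra_notP; rewrite not_orE => -[h1 h2] Ix.
  have d1 : density mu x <= 1.
    by rewrite leNgt; apply/negP => d1; apply: h2.
  have d0 : 0 <= density mu x by rewrite leNgt; apply/negP.
  by rewrite /dens; move/min_idPr : d1 => ->; move/max_idPr : d0 => ->.
Qed.

Lemma integrable_bounded (nu : {finite_measure set (measurableTypeR R) -> \bar R})
   (f : R -> R) (M : R) A : measurable A -> measurable_fun A f ->
  (forall x, A x -> `|f x| <= M) -> nu.-integrable A (EFin \o f).
Proof.
move=> mA mf fM; apply: measurable_bounded_integrable => //.
  by rewrite ltey_eq fin_num_measure.
exists M; split; first exact: num_real.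
by move=> y My x Ax; apply: (le_trans (fM _ Ax)); exact: ltW.
Qed.

Lemma leb_integrable_bounded (f : R -> R) (M : R) A : measurable A -> A `<=` I01 ->
  measurable_fun A f ->
  (forall x, A x -> `|f x| <= M) -> leb.-integrable A (EFin \o f).
Proof.
move=> mA AI mf fM; apply: measurable_bounded_integrable => //.
  apply: (@le_lt_trans _ _ (leb I01)); last by rewrite leb_I01 ltry.
  by apply: le_measure; rewrite ?inE.
exists M; split; first exact: num_real.
by move=> y My x Ax; apply: (le_trans (fM _ Ax)); exact: ltW.
Qed.

Lemma dens_integral mu A : le_leb mu -> measurable A -> A `<=` I01 ->
  mu A = (\int[leb]_(x in A) (dens mu x)%:E)%E.
Proof.
move=> h mA AI; rewrite density_integral//; apply: ae_eq_integral => //.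
- by apply/measurable_EFinP/measurable_funTS; exact: measurable_density.
- by apply/measurable_EFinP/measurable_funTS; exact: measurable_dens.
- by apply: filterS (dens_ae h) => x hx /AI /hx ->.
Qed.

Lemma dens_Rintegral mu (f : R -> R) (M : R) : le_leb mu ->
  measurable_fun I01 f -> (forall x, I01 x -> `|f x| <= M) ->
  (\int[mu]_(x in I01) f x)%R = (\int[leb]_(x in I01) (f x * dens mu x))%R.
Proof.
move=> h mf fM; rewrite /Rintegral; congr fine.
rewrite -(Radon_Nikodym_change_of_variables (mu := leb) (le_leb_dominates h) measurable_I01); last first.
  have := @integrable_bounded mu f M _ measurable_I01 mf fM; exact.
apply: ae_eq_integral => //.
- apply: emeasurable_funM; first exact/measurable_EFinP.
  by apply: measurable_funTS; apply: measurable_int (RN_integrable h).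
- apply/measurable_EFinP; apply: measurable_funM => //.
  by apply: measurable_funTS; exact: measurable_dens.
- by apply: filterS (dens_ae h) => x hx /hx e; rewrite -densityE// e EFinM.
Qed.

(** Truncating the densities does not change the rate function, whose
    integrand becomes bounded. *)
Lemma H321E (p : @calD R) : H321 p =
  (\int[leb]_(x in I01) (2 * ln 2 - entropy (dens (val p).1 x)
     - entropy (dens (val p).2 x))%:E)%E.
Proof.
have [h1 h2 _ _] := set_mem (valP p).
have mxlnx (g : R -> R) : measurable_fun I01 g ->
    measurable_fun I01 (fun x => xlnx (g x)).
  by move=> mg; apply: measurable_funM => //; exact: measurableT_comp.
have m1B (g : R -> R) : measurable_fun I01 g -> measurable_fun I01 (fun x => 1 - g x).
  by move=> mg; exact: measurable_funB.
have ment (g : R -> R) : measurable_fun I01 g ->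
    measurable_fun I01 (fun x => entropy (g x)).
  move=> mg; apply: measurable_funN.
  by apply: measurable_funD; apply: mxlnx => //; exact: m1B.
rewrite /H321; apply: ae_eq_integral.
- exact: measurable_I01.
- apply/measurable_EFinP; apply: measurable_funD => //.
  by do !apply: measurable_funD; apply: mxlnx; try apply: m1B;
    apply: measurable_funTS; exact: measurable_density.
- apply/measurable_EFinP; apply: measurable_funB => //; first apply: measurable_funB => //;
  by apply: ment; apply: measurable_funTS; exact: measurable_dens.
- have := dens_ae h1; apply: filterS2 (dens_ae h2) => x e2 e1 Ix.
  by rewrite e1// e2// /entropy; congr EFin; lra.
Qed.

End density_facts.

(** * Distribution functions and Riemann-Stieltjes sums *)

Section dist_facts.
Variable R : realType.
Notation leb := (@lebesgue_measure R).
Notation I01 := (`[0 : R, 1 : R]%classic).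
Implicit Types (mu : unit_measure R) (A : set (measurableTypeR R)).

(** The cumulative distribution function of mu. *)
Definition dist mu (x : R) : R := fine (mu `[0, x]%classic).

Lemma unit_measure_fin mu A : measurable A -> mu A \is a fin_num.
Proof. by move=> mA; exact: fin_num_measure. Qed.

Lemma distE mu x : (dist mu x)%:E = mu `[0, x]%classic.
Proof. by rewrite /dist fineK// unit_measure_fin. Qed.

Lemma unit_measure_itv mu (a b : R) : 0 <= a <= b ->
  mu `]a, b]%classic = (dist mu b - dist mu a)%:E.
Proof.
move=> /andP[a0 ab].
have E : `[0, b]%classic = `[0, a]%classic `|` `]a, b]%classic :> set R.
  by rewrite -itv_bndbnd_setU// bnd_simp.
have : mu `[0, b]%classic = (mu `[0%R, a]%classic + mu `]a, b]%classic)%E.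
  rewrite E measureU//; apply/seteqP; split => x //=; rewrite !in_itv/=.
  by move=> [/andP[_ xa] /andP[ax _]]; have := lt_le_trans ax xa; rewrite ltxx.
have f1 : mu `]a, b]%classic \is a fin_num by apply: unit_measure_fin.
by rewrite -!distE -(fineK f1) -EFinD => -[->]; congr EFin; lra.
Qed.

Lemma dist_mono mu (a b : R) : 0 <= a <= b -> dist mu a <= dist mu b.
Proof.
move=> ab; rewrite -subr_ge0 -lee_fin -unit_measure_itv//.
Qed.

Lemma dist_lip mu (a b : R) : le_leb mu -> 0 <= a <= b -> b <= 1 ->
  dist mu b - dist mu a <= b - a.
Proof.
move=> h /[dup] ab /andP[a0 ab'] b1; rewrite -lee_fin -unit_measure_itv//.
apply: (le_trans (h _ _ _)) => //.
  move=> x /=; rewrite !in_itv/= => /andP[ax xb]; apply/andP; split; lra.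
rewrite lebesgue_measure_itv/= lte_fin; case: ifP => // _; rewrite lee_fin; lra.
Qed.

Lemma dist0 mu : le_leb mu -> dist mu 0 = 0.
Proof.
move=> h; apply/eqP; rewrite -eqe distE set_itv1 eq_le measure_ge0 andbT.
apply: (le_trans (h _ _ _)) => //; first by move=> x /= ->; rewrite in_itv/=; lra.
by rewrite lebesgue_measure_set1.
Qed.

Lemma dist_ge0 mu x : 0 <= dist mu x.
Proof. by apply: fine_ge0. Qed.

Lemma dist_le mu x : le_leb mu -> 0 <= x <= 1 -> dist mu x <= x.
Proof.
move=> h /andP[x0 x1]; have := @dist_lip mu 0 x h; rewrite dist0//; lra.
Qed.

(** The error estimate on one cell of a Riemann-Stieltjes sum. *)
Lemma Rintegral_osc mu A (f : R -> R) (c e M : R) : measurable A ->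
  measurable_fun A f -> (forall x, A x -> `|f x| <= M) ->
  (forall x, A x -> `|f x - c| <= e) ->
  `|(\int[mu]_(x in A) f x)%R - c * fine (mu A)| <= e * fine (mu A).
Proof.
move=> mA mf fM fe.
have If := @integrable_bounded R mu f M A mA mf fM.
have Ic (k : R) : mu.-integrable A (EFin \o cst k).
  by apply: (@integrable_bounded R mu (cst k) `|k|) => //.
have Ifc : mu.-integrable A (EFin \o (fun x => f x - c)).
  apply: (@integrable_bounded R mu (fun x => f x - c) e) => //.
  exact: measurable_funB.
rewrite -!Rintegral_cst// -RintegralB//; last exact: Ic.
apply: (le_trans (le_normr_Rintegral _ _)) => //.
apply: le_Rintegral => //; last exact: Ic.
have /= := integrable_norm Ifc; exact.
Qed.

Lemma test_bounded (f : test_fun R) : exists M : R, forall x, I01 x -> `|sval f x| <= M.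
Proof.
have cf := svalP f.
have [c1 _ h1] := EVT_max (ler01) cf; have [c2 _ h2] := EVT_min (ler01) cf.
exists (Num.max `|sval f c1| `|sval f c2|) => x Ix.
have := h1 _ Ix; have := h2 _ Ix; rewrite le_max.
move=> m2 m1; have := ler_norm (sval f c1); have := ler_norm (- sval f c2).
by rewrite normrN; case: (ger0P (sval f x)) => ? ? ?; apply/orP; [left|right]; lra.
Qed.

Lemma test_measurable (f : test_fun R) : measurable_fun I01 (sval f).
Proof.
apply: subspace_continuous_measurable_fun; last exact: (svalP f).
exact: measurable_I01.
Qed.

(** Heine's theorem, from the compactness of [0, 1] in its near-covering form,
    with the radius tending to 0 as a parameter. *)
Lemma test_unif (f : test_fun R) (e : R) : 0 < e -> exists2 N : nat, (0 < N)%N &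
  forall x y, I01 x -> I01 y -> `|x - y| <= N%:R^-1 -> `|sval f x - sval f y| <= e.
Proof.
move=> e0.
have /compact_near_coveringP/near_covering_withinP := @segment_compact R 0 1.
move=> /(_ _ (0^'+ : set_system R)
  (fun d x => forall y, I01 y -> `|x - y| <= d -> `|sval f x - sval f y| <= e)).
case.
  move=> x Ix.
  have : \forall y \near within I01 (nbhs x), `|sval f x - sval f y| < e / 2.
    have /subspace_continuousP/(_ x Ix)/cvgrPdist_lt/(_ (e / 2)) := svalP f.
    by apply; lra.
  rewrite near_withinE => /nbhs_ballP[d/= d0 hd].
  exists (ball x (d / 2), [set z | 0 < z < d / 2]); first split.
  - by apply: nbhsx_ballx; lra.
  - by near=> z; apply/andP; split; near: z;
      [exact: nbhs_right_gt|apply: nbhs_right_lt; lra].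
  - move=> [y z] /= [yb /andP[z0 zd]] Iy t It tz.
    have b1 : `|sval f x - sval f y| < e / 2.
      by apply: hd => //; apply: le_ball yb; lra.
    have b2 : `|sval f x - sval f t| < e / 2.
      apply: hd => //; rewrite /ball/=; rewrite /ball/= in yb.
      have := ler_distD y x t; lra.
    have := ler_distD (sval f x) (sval f y) (sval f t).
    by rewrite (distrC _ (sval f x)); lra.
move=> d /= d0 hd.
have [N Nd] : exists N : nat, (N.+1%:R)^-1 < d.
  have [N _ hN] := near_infty_natSinv_lt (PosNum d0).
  by exists N; exact: hN (leqnn N).
exists N.+1 => // x y Ix Iy xy.
apply: (hd (N.+1%:R^-1)) => //; rewrite /= ?sub0r ?normrN ?gtr0_norm ?invr_gt0 ?ltr0n//.
Unshelve. all: by end_near. Qed.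

(** The Riemann-Stieltjes sum of f at the left end points. The point 0 belongs
    to no cell, which is harmless since measures below Lebesgue measure have no
    atoms. *)
Definition rsum mu (f : R -> R) (N : nat) : R :=
  \sum_(i < N) f (i%:R / N%:R) * (dist mu (i.+1%:R / N%:R) - dist mu (i%:R / N%:R)).

(** By induction on the number of cells: on each cell f stays within e of its
    value at the left end point, and the cells have total mass at most 1. *)
Lemma rsumP mu (f : R -> R) (N : nat) (e M : R) : le_leb mu -> (0 < N)%N ->
  measurable_fun I01 f -> (forall x, I01 x -> `|f x| <= M) -> 0 <= e ->
  (forall x y, I01 x -> I01 y -> `|x - y| <= N%:R^-1 -> `|f x - f y| <= e) ->
  `|(\int[mu]_(x in I01) f x)%R - rsum mu f N| <= e.
Proof.
move=> h N0 mf fM e0 fe.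
have N0' : 0 < N%:R :> R by rewrite ltr0n.
suff H j : (j <= N)%N -> `|(\int[mu]_(x in `[0%R, (j%:R / N%:R)%R]) f x)%R -
   \sum_(i < j) f (i%:R / N%:R) * (dist mu (i.+1%:R / N%:R) - dist mu (i%:R / N%:R))|
   <= e * dist mu (j%:R / N%:R).
  have := H N (leqnn N); rewrite divff ?gt_eqF// => /le_trans; apply.
  by rewrite -[leRHS]mulr1 ler_wpM2l// dist_le// ler01 lexx.
have jN i : (i <= N)%N -> I01 (i%:R / N%:R).
  by move=> iN; rewrite /= in_itv/= divr_ge0//= ler_pdivrMr// mul1r ler_nat.
elim: j => [_|j IH jlt].
  rewrite big_ord0 mul0r subr0 dist0// mulr0 set_itv1.
  have := @Rintegral_osc mu [set 0] f 0 M M.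
  have -> : fine (mu [set 0]) = 0 by have := dist0 h; rewrite /dist set_itv1.
  rewrite !mulr0 subr0; apply => //.
  - by apply: measurable_funS mf => // x /= ->; rewrite in_itv/=; lra.
  - by move=> x /= ->; apply: fM; rewrite /= in_itv/=; lra.
  - by move=> x /= ->; rewrite subr0; apply: fM; rewrite /= in_itv/=; lra.
rewrite big_ord_recr/=.
have jj : j%:R / N%:R <= j.+1%:R / N%:R :> R by rewrite ler_pM2r ?invr_gt0// ler_nat.
have jle := ltnW jlt.
have := jN _ jle; have := jN _ jlt; rewrite /= !in_itv/= => /andP[_ b1] /andP[a0 _].
have sA : `]j%:R / N%:R, j.+1%:R / N%:R]%classic `<=` I01.
  by move=> x /=; rewrite !in_itv/= => /andP[? ?]; lra.
have sB : `[0, j%:R / N%:R]%classic `<=` I01.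
  by move=> x /=; rewrite !in_itv/= => /andP[? ?]; lra.
have -> : `[0, j.+1%:R / N%:R]%classic =
    `[0, j%:R / N%:R]%classic `|` `]j%:R / N%:R, j.+1%:R / N%:R]%classic :> set R.
  by rewrite -itv_bndbnd_setU// bnd_simp.
rewrite Rintegral_setU//; last 2 first.
- apply: (@integrable_bounded R mu f M) => //; first exact: measurableU.
  + apply: measurable_funS mf; first exact: measurable_I01.
    by move=> x [/sB|/sA].
  + by move=> x [/sB|/sA]; exact: fM.
- apply/disj_setPS => x /= []; rewrite !in_itv/= => /andP[_ xa] /andP[ax _].
  by have := lt_le_trans ax xa; rewrite ltxx.
have := @Rintegral_osc mu `]j%:R / N%:R, j.+1%:R / N%:R] f (f (j%:R / N%:R)) e M.
rewrite unit_measure_itv ?a0//= => /(_ (measurable_itv _)).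
move=> /(_ (measurable_funS (@measurable_I01 R) sA mf)).
move=> /(_ (fun x Ax => fM x (sA x Ax))) H2.
have : forall x, `]j%:R / N%:R, j.+1%:R / N%:R]%classic x -> `|f x - f (j%:R / N%:R)| <= e.
  move=> x Ax; apply: fe; [exact: sA|exact: jN|].
  move: Ax; rewrite /= in_itv/= => /andP[ax xb]; rewrite ger0_norm; last lra.
  by move: xb; rewrite -natr1 mulrDl mul1r; lra.
move=> /H2 {}H2; have H1 := IH jle.
set I1 := Rintegral _ _ _ in H1 *; set I2 := Rintegral _ _ _ in H2 *.
set S := \sum_(i < j) _ in H1 *.
set T := f _ * _ in H2 *.
rewrite (_ : I1 + I2 - (S + T) = (I1 - S) + (I2 - T)); last by lra.
apply: (le_trans (ler_normD _ _)); lra.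
Qed.

End dist_facts.

(** * Compactness of the domain *)

(** The neighborhoods of an initial topology are generated by preimages. *)
Lemma cvg_initial (S : choiceType) (T : topologicalType) (f : S -> T)
    (F : set_system S) (s : S) : Filter F ->
  f @ F --> f s -> F --> (s : initial_topology f).
Proof.
move=> FF h A; rewrite nbhs_simpl/= nbhsE => -[B [[C oC <-] /= fs] BA].
by apply: filterS BA _; apply: (h C); exact: open_nbhs_nbhs.
Qed.

Section measure_from_dist.
Variables (R : realType) (G : R -> R).
Hypothesis G_lip : forall a b, 0 <= a -> a <= b -> b <= 1 -> 0 <= G b - G a <= b - a.
Hypothesis G0 : G 0 = 0.
Notation leb := (@lebesgue_measure R).
Notation I01 := (`[0 : R, 1 : R]%classic).

Let clamp (x : R) : R := Num.max 0 (Num.min 1 x).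
(** The hypotheses on G are restricted to [0, 1], while Stieltjes measures are
    built from functions on the line: G is extended by constants. *)
Definition clamped (x : R) : R := G (clamp x).
(** The function complementary to [clamped]: nondecreasing as well, because
    [clamped] is 1-Lipschitz. *)
Definition unclamped (x : R) : R := x - clamped x.

Lemma clamped_lip a b : a <= b -> 0 <= clamped b - clamped a <= b - a.
Proof.
move=> ab.
have c01 x : 0 <= clamp x <= 1 by rewrite /clamp le_max lexx/= ge_max ler01/= ge_min lexx.
have ca := c01 a; have cb := c01 b.
have cab : 0 <= clamp b - clamp a <= b - a.
  rewrite /clamp; case: (lerP 1 a) => ?; case: (lerP 1 b) => ?;
  rewrite ?(max_r ler01); try lra;
  by case: (lerP 0 a) => ?; case: (lerP 0 b) => ?; lra.
have := @G_lip (clamp a) (clamp b); rewrite /clamped; lra.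
Qed.

Lemma lip_right_continuous (g : R -> R) :
  (forall a b, a <= b -> 0 <= g b - g a <= b - a) -> right_continuous g.
Proof.
move=> gl; apply: right_continuousW => x; apply/cvgrPdist_le => e e0.
near=> t.
have : `|x - t| <= e by near: t; apply: cvgr_dist_le.
move: (gl x t) (gl t x) => h1 h2; apply: le_trans.
have [/h1|/ltW/h2] := lerP x t; rewrite ler_norml; lra.
Unshelve. all: by end_near. Qed.

Lemma clamped_nd : nondecreasing clamped.
Proof. by move=> a b /clamped_lip; lra. Qed.

Lemma clamped_rc : right_continuous clamped.
Proof. by apply: lip_right_continuous; exact: clamped_lip. Qed.

HB.instance Definition _ := isCumulative.Build R _ R clamped clamped_nd clamped_rc.

Lemma unclamped_lip a b : a <= b -> 0 <= unclamped b - unclamped a <= b - a.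
Proof. by move=> /clamped_lip; rewrite /unclamped; lra. Qed.

Lemma unclamped_nd : nondecreasing unclamped.
Proof. by move=> a b /unclamped_lip; lra. Qed.

Lemma unclamped_rc : right_continuous unclamped.
Proof. by apply: lip_right_continuous; exact: unclamped_lip. Qed.

HB.instance Definition _ := isCumulative.Build R _ R unclamped unclamped_nd unclamped_rc.

Let nu := lebesgue_stieltjes_measure clamped.
Let nu' := lebesgue_stieltjes_measure unclamped.

Lemma stieltjes_itvoc (g : cumulative R R) (a b : R) : a <= b ->
  lebesgue_stieltjes_measure g `]a, b]%classic = (g b - g a)%:E.
Proof.
move=> ab; rewrite /lebesgue_stieltjes_measure/= /measure_extension/=.
by rewrite measurable_mu_extE//; [exact: wlength_itv_bnd|exact: is_ocitv].
Qed.

(** The Stieltjes measures of [clamped] and [unclamped] add up to Lebesgue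
    measure, since they do so on intervals. *)
Lemma nu_le (A : set (measurableTypeR R)) : measurable A -> (nu A <= leb A)%E.
Proof.
move=> mA.
have -> : leb A = measure_add nu nu' A.
  apply: lebesgue_measure_unique => // X [[a b] _ <-] /=.
  have [ab|ba] := lerP a b; last first.
    rewrite set_itv_ge ?bnd_simp -?leNgt ?ltW// /nu /nu' !measure0.
    by [].
  rewrite /msum big_ord_recr big_ord1/= /nu /nu' !stieltjes_itvoc// -EFinD /lebesgue_measure.
  by rewrite stieltjes_itvoc//=; congr EFin; rewrite /unclamped; lra.
by rewrite measure_addE leeDl.
Qed.

Lemma nu_I01 : (nu I01 < +oo)%E.
Proof.
by apply: (le_lt_trans (nu_le (@measurable_I01 R))); rewrite leb_I01 ltry.
Qed.

Lemma nu_carried : mfrestr (@measurable_I01 R) nu_I01 (~` I01) = 0%E.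
Proof. by rewrite /mfrestr /mrestr setICl /nu measure0. Qed.

Lemma exists_measure_dist : exists2 mu : unit_measure R, le_leb mu &
  forall x, 0 <= x <= 1 -> dist mu x = G x.
Proof.
pose mu := UnitMeasure nu_carried.
have muE (A : set (measurableTypeR R)) : A `<=` I01 -> mu A = nu A.
  by move=> AI; rewrite /mu/= /mfrestr/= /mrestr (setIidl AI).
have h : le_leb mu by move=> A mA AI; rewrite muE//; exact: nu_le.
exists mu => // x x01; apply/eqP; rewrite -eqe; apply/eqP.
have := @unit_measure_itv R mu 0 x; rewrite dist0// subr0 => <-; last lra.
case/andP: x01 => x0 x1.
rewrite muE; last by move=> y /=; rewrite !in_itv/= => /andP[? ?]; lra.
rewrite /nu stieltjes_itvoc//=.
congr EFin; rewrite /clamped /clamp (min_r ler01) maxxx G0.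
by rewrite subr0 min_r ?max_r//; lra.
Qed.

End measure_from_dist.

Section topology_D.
Variable R : realType.
Notation I01 := (`[0 : R, 1 : R]%classic).

Lemma cvg_unit_measure (F : set_system (unit_measure R)) (mu : unit_measure R) :
  Filter F ->
  (forall f : test_fun R, (fun q : unit_measure R => (\int[q]_(x in I01) sval f x)%R) @ F -->
     (\int[mu]_(x in I01) sval f x)%R) -> F --> mu.
Proof.
move=> FF h; apply: cvg_initial.
apply/cvg_sup => f; apply: cvg_initial.
exact: h.
Qed.

Lemma cvg_calD_test (F : set_system (@calD R)) (p : @calD R) : Filter F ->
  (forall f : test_fun R, (fun q : @calD R => (\int[(val q).1]_(x in I01) sval f x)%R) @ F -->
     (\int[(val p).1]_(x in I01) sval f x)%R) ->
  (forall f : test_fun R, (fun q : @calD R => (\int[(val q).2]_(x in I01) sval f x)%R) @ F -->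
     (\int[(val p).2]_(x in I01) sval f x)%R) -> F --> p.
Proof.
move=> FF h1 h2; apply: cvg_initial.
have H1 : (fun q : @calD R => (val q).1) @ F --> (val p).1.
  by apply: cvg_unit_measure => f; exact: h1.
have H2 : (fun q : @calD R => (val q).2) @ F --> (val p).2.
  by apply: cvg_unit_measure => f; exact: h2.
have := cvg_pair H1 H2.
rewrite (_ : (fun x => _) = set_val); last first.
  by apply/funext => q; rewrite -surjective_pairing.
have -> : set_val p = ((val p).1, (val p).2) by exact: surjective_pairing.
by apply.
Qed.

(** The integral of a continuous function is approximated by
    Riemann-Stieltjes sums uniformly over all measures below Lebesgue measure,
    and such a sum involves the distribution function at finitely many points. *)
Lemma cvg_int_dist (F : set_system (@calD R)) (m : @calD R -> unit_measure R)
   (mu : unit_measure R) (f : test_fun R) : Filter F ->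
  (forall q, le_leb (m q)) -> le_leb mu ->
  (forall x, 0 <= x <= 1 -> (fun q => dist (m q) x) @ F --> dist mu x) ->
  (fun q => (\int[m q]_(x in I01) sval f x)%R) @ F --> (\int[mu]_(x in I01) sval f x)%R.
Proof.
move=> FF hm hmu hd; apply/cvgrPdist_le => e e0.
have e3 : 0 < e / 3 by lra.
have [N N0 fN] := test_unif f e3.
have [M fM] := test_bounded f.
have mf := test_measurable f.
have N0' : 0 < N%:R :> R by rewrite ltr0n.
have cs : (fun q => rsum (m q) (sval f) N) @ F --> rsum mu (sval f) N.
  apply: cvg_big => [|i _]; first exact: add_continuous.
  apply: cvgM; first exact: cvg_cst.
  apply: cvgB; apply: hd; rewrite divr_ge0//= ler_pdivrMr// mul1r ler_nat//.
  exact: ltnW.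
move/cvgrPdist_le : cs => /(_ _ e3); apply: filterS => q h.
have h1 := rsumP (hm q) N0 mf fM (ltW e3) fN.
have h2 := rsumP hmu N0 mf fM (ltW e3) fN.
move: h h1 h2; rewrite !ler_norml; lra.
Qed.

(** Reduces convergence in the domain to convergence of real numbers; both the
    compactness of the domain and the lower bound rest on it. *)
Lemma cvg_calD (F : set_system (@calD R)) (p : @calD R) : Filter F ->
  (forall x, 0 <= x <= 1 -> (fun q : @calD R => dist (val q).1 x) @ F --> dist (val p).1 x) ->
  (forall x, 0 <= x <= 1 -> (fun q : @calD R => dist (val q).2 x) @ F --> dist (val p).2 x) ->
  F --> p.
Proof.
move=> FF h1 h2.
have lD (q : @calD R) : le_leb (val q).1 /\ le_leb (val q).2.
  by have [] := set_mem (valP q).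
apply: cvg_calD_test => f.
- by apply: (@cvg_int_dist F (fun q => (val q).1)) => //; try (by move=> q; have [] := lD q); have [] := lD p.
- by apply: (@cvg_int_dist F (fun q => (val q).2)) => //; try (by move=> q; have [] := lD q); have [] := lD p.
Qed.

Lemma ultra_fmap (S T : Type) (f : S -> T) (U : set_system S) : UltraFilter U ->
  UltraFilter (f @ U).
Proof.
move=> UU; split=> [|G PG UG]; first exact: fmap_proper_filter.
rewrite predeqE => A; split; last exact: UG.
move=> GA; have [//|nA] := in_ultra_setVsetC (f @^-1` A) UU.
by have /filter_ex[x []] : G (A `&` ~` A) by apply: filterI GA _; exact: UG.
Qed.

Lemma ultra_limit (U : set_system (@calD R)) (g : @calD R -> R) : UltraFilter U ->
  (forall q, 0 <= g q <= 1) -> exists l : R, g @ U --> l.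
Proof.
move=> UU g01; have := @segment_compact R 0 1; rewrite compact_ultra.
move=> /(_ (g @ U) (ultra_fmap g UU)) [].
  by apply: nearW => q; rewrite /= in_itv/= g01.
by move=> l [_ h]; exists l.
Qed.

(** Along an ultrafilter the distribution functions converge at each point,
    being bounded. The limits inherit monotonicity, the Lipschitz bound and the
    ordering, hence come from a point of the domain ([exists_measure_dist]),
    to which the ultrafilter converges by [cvg_calD]. *)
Lemma compact_calD : compact [set: @calD R].
Proof.
rewrite compact_ultra => U UU _.
have lD (q : @calD R) := set_mem (valP q).
have d01 (mu : unit_measure R) x : le_leb mu -> 0 <= x <= 1 -> 0 <= dist mu x <= 1.
  move=> h x01; rewrite dist_ge0/=; apply: (le_trans (dist_le h x01)); lra.
have clampx (x : R) : 0 <= Num.max 0 (Num.min 1 x) <= 1.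
  by rewrite le_max lexx/= ge_max ler01/= ge_min lexx.
have L (m : @calD R -> unit_measure R) : (forall q, le_leb (m q)) ->
   {G : R -> R | forall x, 0 <= x <= 1 -> (fun q => dist (m q) x) @ U --> G x}.
  move=> hm.
  have H x : exists l : R, 0 <= x <= 1 -> (fun q => dist (m q) x) @ U --> l.
    have [x01|x01] := pselect (0 <= x <= 1); last by exists 0.
    have [l hl] := ultra_limit UU (fun q => d01 (m q) x (hm q) x01).
    by exists l.
  by exists (fun x => projT1 (cid (H x))) => x; case: (cid (H x)).
have [G1 hG1] := L (fun q => (val q).1) (fun q => let: And4 h _ _ _ := lD q in h).
have [G2 hG2] := L (fun q => (val q).2) (fun q => let: And4 _ h _ _ := lD q in h).
have PU : ProperFilter U := @ultra_proper _ _ UU.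
have lip (m : @calD R -> unit_measure R) (G : R -> R) : (forall q, le_leb (m q)) ->
    (forall x, 0 <= x <= 1 -> (fun q => dist (m q) x) @ U --> G x) ->
    forall a b, 0 <= a -> a <= b -> b <= 1 -> 0 <= G b - G a <= b - a.
  move=> hm hG a b a0 ab b1.
  have cab : (fun q => dist (m q) b - dist (m q) a) @ U --> G b - G a.
    by apply: cvgB; apply: hG; lra.
  have : `[0, b - a]%classic (G b - G a).
    apply: (@closed_cvg _ _ U PU _ _ _ _ _ cab); first exact: itv_closed_ends_closed.
    apply: nearW => q; rewrite /= in_itv/= subr_ge0.
    by rewrite dist_mono ?a0//= dist_lip ?a0.
  by rewrite /= in_itv.
have z (m : @calD R -> unit_measure R) (G : R -> R) : (forall q, le_leb (m q)) ->
    (forall x, 0 <= x <= 1 -> (fun q => dist (m q) x) @ U --> G x) -> G 0 = 0.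
  move=> hm hG; have := hG 0; rewrite lexx ler01 => /(_ isT) h.
  apply: (cvg_unique _ h) => //.
  have -> : (fun q => dist (m q) 0) = cst 0 by apply/funext => q; exact: dist0.
  exact: cvg_cst.
have l1 : forall q : @calD R, le_leb (val q).1 by move=> q; have [] := lD q.
have l2 : forall q : @calD R, le_leb (val q).2 by move=> q; have [] := lD q.
have [m1 hm1 d1] := exists_measure_dist (lip _ _ l1 hG1) (z _ _ l1 hG1).
have [m2 hm2 d2] := exists_measure_dist (lip _ _ l2 hG2) (z _ _ l2 hG2).
have G12 x : 0 <= x <= 1 -> 0 <= G2 x - G1 x.
  move=> x01.
  have cab : (fun q : @calD R => dist (val q).2 x - dist (val q).1 x) @ U --> G2 x - G1 x.
    by apply: cvgB; [exact: hG2|exact: hG1].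
  have : `[0, +oo[%classic (G2 x - G1 x).
    apply: (@closed_cvg _ _ U PU _ _ _ _ _ cab); first exact: itv_closed_ends_closed.
    apply: nearW => q; rewrite /= in_itv/= andbT subr_ge0.
    by have [_ _ _ h] := lD q; rewrite -lee_fin !distE; apply: h; rewrite in_itv.
  by rewrite /= in_itv/= andbT.
have i1 : (0 : R) <= (1 : R) <= (1 : R) by apply/andP; split; rewrite ?ler01 ?lexx.
have G11 : G1 1 = G2 1.
  apply: (cvg_unique _ (hG1 1 i1)) => //.
  have -> : (fun q : @calD R => dist (val q).1 1) = (fun q => dist (val q).2 1).
    by apply/funext => q; have [_ _ h _] := lD q; rewrite /dist h.
  exact: hG2.
have pD : (m1, m2) \in @calD R.
  rewrite inE; split => //=.
    by apply/eqP; rewrite -!distE eqe d1// d2// G11.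
  move=> x; rewrite in_itv/= => x01; rewrite -!distE lee_fin d1// d2//.
  by rewrite -subr_ge0 G12.
exists (SigSub pD : @calD R); split => //.
apply: cvg_calD => x x01 /=.
- by rewrite d1//; exact: hG1.
- by rewrite d2//; exact: hG2.
Qed.

End topology_D.

(** * The rate function as a supremum of continuous functionals *)

Section duality.
Variable R : realType.
Notation leb := (@lebesgue_measure R).
Notation I01 := (`[0 : R, 1 : R]%classic).
Implicit Types (mu : unit_measure R).

Lemma log1pexp_lip (f g : R) : `|log1pexp f - log1pexp g| <= `|f - g|.
Proof.
wlog fg : f g / f <= g.
  move=> h; have [/h//|/ltW/h] := leP f g.
  by rewrite distrC (distrC g).
have pos x : 0 < 1 + expR x :> R by rewrite addr_gt0// expR_gt0.
have h1 : log1pexp f <= log1pexp g.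
  by rewrite /log1pexp ler_ln ?posrE// lerD2l ler_expR.
have h2 : log1pexp g <= (g - f) + log1pexp f.
  rewrite -[g - f]expRK /log1pexp -lnM ?posrE ?expR_gt0// ler_ln ?posrE ?mulr_gt0 ?expR_gt0//.
  rewrite mulrDr mulr1 -expRD subrK lerD2r -expR0 ler_expR subr_ge0//.
by rewrite !ler0_norm; lra.
Qed.

Lemma log1pexp_bound (f : R) : `|log1pexp f| <= ln 2 + `|f|.
Proof.
have := log1pexp_lip f 0; rewrite subr0.
have -> : log1pexp 0 = ln 2 :> R by rewrite /log1pexp expR0.
have : 0 <= ln 2 :> R by rewrite ln_ge0// ler1n.
move=> h1 h2; have := ler_normD (log1pexp f - ln 2) (ln 2); rewrite subrK.
rewrite (ger0_norm h1); lra.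
Qed.

Lemma measurable_log1pexp : measurable_fun setT (@log1pexp R).
Proof.
apply: measurableT_comp; first exact: measurable_ln.
by apply: measurable_funD => //; exact: measurable_expR.
Qed.

Lemma measurable_entropy : measurable_fun setT (@entropy R).
Proof.
have mx : measurable_fun setT (@xlnx R).
  by apply: measurable_funM => //; exact: measurable_ln.
apply: measurable_funN; apply: measurable_funD => //.
by apply: measurableT_comp => //; exact: measurable_funB.
Qed.

Lemma measurable_logit e : 0 < e -> measurable_fun I01 (@logit R e).
Proof.
move=> e0.
have E : {in I01, (fun r => ln (r + e) - ln (1 - r + e)) =1 @logit R e}.
  move=> r; rewrite inE/= in_itv/= => /andP[? ?].
  by rewrite /logit ln_div ?posrE//; lra.
apply: (eq_measurable_fun _ E).
apply: measurable_funTS; apply: measurable_funB; apply: measurableT_comp;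
 try exact: measurable_ln; apply: measurable_funD => //.
exact: measurable_funB.
Qed.

Lemma Rintegral_I01_cst (c : R) : (\int[leb]_(x in I01) c)%R = c.
Proof. transitivity (c * fine (leb I01)); first exact: Rintegral_cst.
by rewrite leb_I01 mulr1. Qed.

(** The mean entropy of the density, in terms of which [H321] is
    [2 * ln 2 - meanent p1 - meanent p2] ([H321_meanent]). *)
Definition meanent mu : R := (\int[leb]_(x in I01) entropy (dens mu x))%R.

(** The integrated form of [r * f - log1pexp f]; its supremum over f is
    [- meanent mu]. *)
Definition Jdual mu (f : R -> R) : R :=
  (\int[mu]_(x in I01) f x)%R - (\int[leb]_(x in I01) log1pexp (f x))%R.

Lemma entropy_dens_integrable mu : le_leb mu ->
  leb.-integrable I01 (EFin \o (fun x => entropy (dens mu x))).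
Proof.
move=> h; apply: (@leb_integrable_bounded R _ (ln 2)) => //.
  apply: measurableT_comp; first exact: measurable_entropy.
  by apply: measurable_funTS; exact: measurable_dens.
move=> x _; rewrite ger0_norm ?entropy_le_ln2 ?entropy_ge0//; exact: dens01.
Qed.

Lemma JdualE mu (f : R -> R) (M : R) : le_leb mu -> measurable_fun I01 f ->
  (forall x, I01 x -> `|f x| <= M) ->
  Jdual mu f = (\int[leb]_(x in I01) (f x * dens mu x - log1pexp (f x)))%R /\
  leb.-integrable I01 (EFin \o (fun x => f x * dens mu x - log1pexp (f x))).
Proof.
move=> h mf fM.
have i1 : leb.-integrable I01 (EFin \o (fun x => f x * dens mu x)).
  apply: (@leb_integrable_bounded R _ M) => //.
    apply: measurable_funM => //; apply: measurable_funTS; exact: measurable_dens.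
  move=> x Ix; rewrite normrM; have := fM _ Ix; have /andP[d0 d1] := dens01 mu x.
  rewrite (ger0_norm d0) => fx; have := normr_ge0 (f x); nra.
have i2 : leb.-integrable I01 (EFin \o (fun x => log1pexp (f x))).
  apply: (@leb_integrable_bounded R _ (ln 2 + M)) => //.
    by apply: measurableT_comp => //; exact: measurable_log1pexp.
  move=> x Ix; apply: (le_trans (log1pexp_bound _)); rewrite lerD2l.
  exact: fM.
split; first by rewrite /Jdual (dens_Rintegral h mf fM) -RintegralB.
have -> : EFin \o (fun x => f x * dens mu x - log1pexp (f x)) =
  ((EFin \o (fun x => (f x * dens mu x)%R)) \- (EFin \o (fun x => log1pexp (f x))))%E.
  by apply/funext.
exact: integrableB.
Qed.

Lemma Jdual_le mu (f : test_fun R) : le_leb mu -> Jdual mu (sval f) <= - meanent mu.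
Proof.
move=> h; have [M fM] := test_bounded f.
have [-> i1] := JdualE h (test_measurable f) fM.
have -> : - meanent mu = (\int[leb]_(x in I01) (-1 * entropy (dens mu x)))%R.
  by rewrite RintegralZl ?mulN1r//; exact: entropy_dens_integrable.
apply: le_Rintegral => //.
  have := entropy_dens_integrable h => /(integrableZl (@measurable_I01 R) (-1)).
  by apply: eq_integrable => // x _; rewrite /= EFinM.
move=> x _; have := entropy_le (sval f x) (dens01 mu x); lra.
Qed.

(** The optimal f would be the logit of the density, which is neither bounded
    nor continuous. It becomes bounded through the parameter of [logit], and
    then continuous by density of continuous functions in L1; the functional
    is 2-Lipschitz for the L1 distance. *)
Lemma Jdual_ge mu e : le_leb mu -> 0 < e ->
  exists f : test_fun R, - meanent mu - e <= Jdual mu (sval f).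
Proof.
move=> h e0; have e4 : 0 < e / 4 by lra.
pose F x := logit (e / 4) (dens mu x).
have mF : measurable_fun I01 F.
  apply: (measurable_comp (F := I01)) => //.
  - by move=> _ [x _ <-]; rewrite /= in_itv/=; exact: dens01.
  - exact: measurable_logit.
  - by apply: measurable_funTS; exact: measurable_dens.
have iF : leb.-integrable I01 (EFin \o F).
  apply: (@leb_integrable_bounded R _ (ln ((1 + e / 4) / (e / 4)))) => //.
  by move=> x _; apply: logit_bound => //; exact: dens01.
have fin : (leb I01 < +oo)%E by rewrite leb_I01 ltry.
have [g [cg ig]] := approximation_continuous_integrable (@measurable_I01 R) fin iF.
move=> /fine_cvgP[_ /cvgrPdist_lt /(_ _ e4)] [n _ /(_ n (leqnn n))] /=.
rewrite sub0r normrN ger0_norm ?fine_ge0 ?integral_ge0// => hn.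
have cgn : {within `[0, 1], continuous (g n)} by apply: continuous_subspaceT; exact: cg.
exists (exist _ (g n) cgn) => /=.
have [M fM] := test_bounded (exist _ (g n) cgn).
have mg := test_measurable (exist _ (g n) cgn).
rewrite /= in fM mg.
have [-> i1] := JdualE h mg fM.
have ie := entropy_dens_integrable h.
have id : leb.-integrable I01 (EFin \o (fun x => `|F x - g n x|)).
  have := integrable_norm (integrableB (@measurable_I01 R) iF (ig n)).
  exact.
have hn' : (\int[leb]_(x in I01) `|F x - g n x|)%R < e / 4 by exact: hn.
have ic : leb.-integrable I01 (EFin \o cst (e / 2)).
  by apply: (@leb_integrable_bounded R _ `|e / 2|).
have iz (k : R) (u : R -> R) : leb.-integrable I01 (EFin \o u) ->
    leb.-integrable I01 (EFin \o (fun x => k * u x)).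
  move=> /(integrableZl (@measurable_I01 R) k).
  by apply: eq_integrable => // x _; rewrite /= EFinM.
have iD (u v : R -> R) : leb.-integrable I01 (EFin \o u) -> leb.-integrable I01 (EFin \o v) ->
    leb.-integrable I01 (EFin \o (fun x => u x + v x)).
  by move=> iu iv; have := integrableD (@measurable_I01 R) iu iv; exact.
(* Replacing [F] by [g n] costs one times their distance in the linear term
   and once more in [log1pexp], hence the factor 2. *)
have : (\int[leb]_(x in I01) (-1 * entropy (dens mu x) + (-2 * `|F x - g n x| + - (e / 2))))%R
    <= (\int[leb]_(x in I01) (g n x * dens mu x - log1pexp (g n x)))%R.
  apply: le_Rintegral => //.
    apply: (iD (fun x => -1 * _) (fun x => -2 * _ + - (e / 2))); first exact: iz.
    apply: (iD (fun x => -2 * _) (fun x => - (e / 2))); first exact: iz.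
    by apply: (@leb_integrable_bounded R _ `|- (e / 2)|).
  move=> x _; have d01 := dens01 mu x.
  have := entropy_ge d01 e4; rewrite -/(F x).
  have := log1pexp_lip (F x) (g n x).
  have /andP[d0 d1] := d01.
  have : `|(F x - g n x) * dens mu x| <= `|F x - g n x|.
    by rewrite normrM (ger0_norm d0); have := normr_ge0 (F x - g n x); nra.
  rewrite !ler_norml; lra.
rewrite RintegralD//; last 2 first.
- exact: iz.
- apply: (iD (fun x => -2 * _) (fun x => - (e / 2))); first exact: iz.
  by apply: (@leb_integrable_bounded R _ `|- (e / 2)|).
rewrite RintegralD//; last 2 first.
- exact: iz.
- by apply: (@leb_integrable_bounded R _ `|- (e / 2)|).
rewrite !RintegralZl// Rintegral_I01_cst -/(meanent mu).
move: hn'; set u := Rintegral _ _ _; set v := Rintegral _ _ _.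
by move: u v (meanent mu) => u v w; lra.
Qed.

Lemma H321_meanent (p : @calD R) :
  H321 p = (2 * ln 2 - meanent (val p).1 - meanent (val p).2)%:E.
Proof.
have [h1 h2 _ _] := set_mem (valP p).
have i1 := entropy_dens_integrable h1; have i2 := entropy_dens_integrable h2.
have ic : leb.-integrable I01 (EFin \o cst (2 * ln 2)).
  by apply: (@leb_integrable_bounded R _ `|2 * ln 2|).
have i3 : leb.-integrable I01 (EFin \o (fun x => 2 * ln 2 - entropy (dens (val p).1 x))).
  by have := integrableB (@measurable_I01 R) ic i1; exact.
have i4 : leb.-integrable I01 (EFin \o (fun x => 2 * ln 2 - entropy (dens (val p).1 x)
     - entropy (dens (val p).2 x))).
  by have := integrableB (@measurable_I01 R) i3 i2; exact.
rewrite H321E -[LHS]fineK; last exact: (integrable_fin_num (@measurable_I01 R) i4).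
congr EFin; rewrite -[LHS]/(Rintegral _ _ _) RintegralB// RintegralB//.
by rewrite Rintegral_I01_cst.
Qed.

Lemma meanent_le mu : le_leb mu -> meanent mu <= ln 2.
Proof.
move=> h; rewrite -(Rintegral_I01_cst (ln 2)); apply: le_Rintegral => //.
- exact: entropy_dens_integrable.
- by apply: (@leb_integrable_bounded R _ `|ln 2|).
- by move=> x _; apply: entropy_le_ln2; exact: dens01.
Qed.

Lemma H321_ge0 (p : @calD R) : (0 <= H321 p)%E.
Proof.
have [h1 h2 _ _] := set_mem (valP p).
rewrite H321_meanent lee_fin.
by move: (meanent _) (meanent _) (meanent_le h1) (meanent_le h2) => u v; lra.
Qed.

Definition Psi (f g : test_fun R) (p : @calD R) : R :=
  2 * ln 2 + Jdual (val p).1 (sval f) + Jdual (val p).2 (sval g).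

Lemma Psi_le f g p : ((Psi f g p)%:E <= H321 p)%E.
Proof.
have [h1 h2 _ _] := set_mem (valP p).
rewrite H321_meanent lee_fin /Psi.
move: (Jdual_le f h1) (Jdual_le g h2).
move: (Jdual (val p).1 _) (Jdual (val p).2 _) => a b.
by move: (meanent (val p).1) (meanent (val p).2) => u v; lra.
Qed.

Lemma Psi_approx (a : R) p : (a%:E < H321 p)%E -> exists f g, a < Psi f g p.
Proof.
have [h1 h2 _ _] := set_mem (valP p).
rewrite H321_meanent lte_fin => ah.
have e0 : 0 < (2 * ln 2 - meanent (val p).1 - meanent (val p).2 - a) / 3.
  by move: (meanent (val p).1) (meanent (val p).2) ah => u v; lra.
have [f hf] := Jdual_ge h1 e0; have [g hg] := Jdual_ge h2 e0.
exists f, g; rewrite /Psi; move: ah hf hg.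
move: (Jdual (val p).1 _) (Jdual (val p).2 _) => x y.
by move: (meanent (val p).1) (meanent (val p).2) => u v; lra.
Qed.

Lemma continuous_int (f : test_fun R) :
  continuous (fun mu : unit_measure R => (\int[mu]_(x in I01) sval f x)%R).
Proof.
move=> mu.
have h1 := @initial_continuous _ _ (@unit_measure_eval R) mu.
move/cvg_sup : h1 => /(_ _ f) h1.
apply: (@cvg_comp _ _ _ (@unit_measure_eval R) (fun u : test_fun R -> R => u f) _ _ _ (h1 _)).
- by apply: fmap_filter; exact: (@nbhs_filter (unit_measure R)).
- exact: (@initial_continuous _ _ (fun u : test_fun R -> R => u f)).
Qed.

Lemma continuous_Psi f g : continuous (Psi f g).
Proof.
move=> p.
have sv : set_val @ nbhs p --> set_val p by exact: (@initial_continuous _ _ set_val p).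
have c1 : {for p, continuous (fun q : @calD R => (\int[(val q).1]_(x in I01) sval f x)%R)}.
  apply: (@cvg_comp _ _ _ (fun q : @calD R => (val q).1)
    (fun mu : unit_measure R => (\int[mu]_(x in I01) sval f x)%R) (nbhs p) (nbhs (val p).1));
    last exact: continuous_int.
  by apply: cvg_comp sv _; exact: cvg_fst.
have c2 : {for p, continuous (fun q : @calD R => (\int[(val q).2]_(x in I01) sval g x)%R)}.
  apply: (@cvg_comp _ _ _ (fun q : @calD R => (val q).2)
    (fun mu : unit_measure R => (\int[mu]_(x in I01) sval g x)%R) (nbhs p) (nbhs (val p).2));
    last exact: continuous_int.
  by apply: cvg_comp sv _; exact: cvg_snd.
exact: (cvgD (cvgD (cvg_cst _) (cvgB c1 (cvg_cst _))) (cvgB c2 (cvg_cst _))).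
Qed.

(** A supremum of continuous functionals is lower semicontinuous. *)
Lemma H321_lsc : lower_semicontinuous (@H321 R).
Proof.
move=> p a /Psi_approx[f [g afg]].
exists (Psi f g @^-1` [set r | a < r]).
  apply: continuous_Psi; apply: open_nbhs_nbhs; split => //; exact: open_gt.
by move=> q /= aq; apply: lt_le_trans (Psi_le f g q); rewrite lte_fin.
Qed.

End duality.

(** * 321-avoiding permutations as pairs of sets *)

Section counting.
Local Open Scope nat_scope.
Variable n : nat.
Implicit Types (A B : {set 'I_n}) (s t : 'S_n).

Definition cnt A (k : nat) : nat := #|[set x in A | x < k]%SET|.

Lemma cnt_mono A k l : k <= l -> cnt A k <= cnt A l.
Proof.
move=> kl; apply: subset_leq_card; apply/fintype.subsetP => x; rewrite !inE => /andP[-> /= xk].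
exact: leq_trans kl.
Qed.

Lemma cntS_in A (a : 'I_n) : a \in A -> cnt A a.+1 = (cnt A a).+1.
Proof.
move=> aA; rewrite /cnt (_ : [set x in A | x < a.+1]%SET = a |: [set x in A | x < a])%SET.
  by rewrite cardsU1 !inE ltnn andbF.
apply/setP => x; rewrite !inE ltnS leq_eqVlt.
have [->|xa] := eqVneq x a; first by rewrite aA eqxx.
by rewrite (_ : (val x == val a) = false)//; apply: negbTE.
Qed.

Lemma cntS_le A k : cnt A k.+1 <= (cnt A k).+1.
Proof.
have [kn|nk] := ltnP k n; last first.
  apply: leq_trans (leqnSn _); apply: subset_leq_card; apply/fintype.subsetP => x.
  by rewrite !inE => /andP[-> _] /=; apply: leq_trans nk.
have [kA|kA] := boolP (Ordinal kn \in A); first by rewrite (cntS_in kA).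
apply: leq_trans (leqnSn _); apply: subset_leq_card; apply/fintype.subsetP => x.
rewrite !inE => /andP[xA]; rewrite xA ltnS leq_eqVlt => /orP[/eqP xk|//].
by case/negP: kA; rewrite (_ : Ordinal kn = x)//; apply: val_inj.
Qed.

Lemma cnt_lip A k l : k <= l -> cnt A l <= cnt A k + (l - k).
Proof.
move=> /subnK <-; elim: (l - k) => [|d IH]; first by rewrite add0n subnn addn0.
rewrite addSn (leq_trans (cntS_le _ _))//; move: IH; rewrite !addnK -addSn addnK; lia.
Qed.

Lemma cnt_lt n' : n' <= n -> #|[set x : 'I_n | x < n']%SET| = n'.
Proof.
move=> nn; rewrite -[RHS]card_ord.
rewrite -[RHS](card_imset predT (f := widen_ord nn)); last first.
  by move=> x y /(congr1 val)/= /val_inj.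
apply: eq_card => x; rewrite inE; apply/idP/imsetP => [xn|[y _ ->]]; last exact: (ltn_ord y).
by exists (Ordinal xn) => //; apply: val_inj.
Qed.

Lemma cntC A k : k <= n -> cnt A k + cnt (~: A)%SET k = k.
Proof.
move=> kn; rewrite -[RHS](cnt_lt kn) -(cardsID A [set x : 'I_n | x < k]%SET).
by congr (_ + _); apply: eq_card => x; rewrite !inE andbC.
Qed.

Lemma cnt_full A : cnt A n = #|A|.
Proof. by apply: eq_card => x; rewrite !inE ltn_ord andbT. Qed.

(** An element of A is determined by the number of elements of A before it. *)
Lemma cnt_inj A (x y : 'I_n) : x \in A -> y \in A -> cnt A x = cnt A y -> x = y.
Proof.
wlog xy : x y / x <= y.
  move=> h xA yA e; have [xy|/ltnW yx] := leqP x y; first exact: h.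
  by apply/esym; apply: h.
move=> xA yA e; apply: val_inj; apply/eqP; rewrite eqn_leq xy /= leqNgt.
apply/negP => lxy; have := cnt_mono A lxy; rewrite cntS_in// e; lia.
Qed.

Definition increasing_on s A := forall x y, x \in A -> y \in A -> x < y -> s x < s y.

Lemma increasing_on_mono s A x y : increasing_on s A -> x \in A -> y \in A ->
  (s x < s y) = (x < y).
Proof.
move=> h xA yA; apply/idP/idP; last exact: h.
move=> sxy; rewrite ltnNge leq_eqVlt; apply/negP => /orP[/eqP/val_inj yx|/h].
  by rewrite yx ltnn in sxy.
by move=> /(_ yA xA) /(ltn_trans sxy); rewrite ltnn.
Qed.

Lemma cnt_imset s A a : increasing_on s A -> a \in A ->
  cnt (s @: A)%SET (s a) = cnt A a.
Proof.
move=> h aA; rewrite /cnt -(card_imset [set x in A | x < a]%SET (@perm_inj _ s)).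
apply: eq_card => y; rewrite inE; apply/andP/imsetP.
  move=> [/imsetP[x xA ->] xa]; exists x => //; rewrite inE xA /=.
  by rewrite -(increasing_on_mono h).
move=> [x]; rewrite inE => /andP[xA xa] ->; split; first exact: imset_f.
by rewrite (increasing_on_mono h).
Qed.

(** The increasing bijection between two finite sets of numbers is unique: it
    preserves the number of predecessors within the sets. *)
Lemma increasing_on_inj s t A : increasing_on s A -> increasing_on t A ->
  (s @: A = t @: A)%SET -> {in A, s =1 t}.
Proof.
move=> hs ht e a aA; apply: (@cnt_inj (s @: A)%SET).
- exact: imset_f.
- by rewrite e; exact: imset_f.
- by rewrite cnt_imset// e cnt_imset.
Qed.

(** In a 321-avoiding permutation these are all the positions with [s a < a]
    ([Av321_defpos]). *)
Definition defpos s : {set 'I_n} := [set a | strict_rlmin s (a, s a)]%SET.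
Definition defval s : {set 'I_n} := (s @: defpos s)%SET.

Lemma defposP s a : reflect (s a < a /\ forall c : 'I_n, a < c -> s a < s c) (a \in defpos s).
Proof.
rewrite inE /strict_rlmin /= eqxx /=; apply: (iffP andP) => -[h1 h2]; split => //.
  by move=> c ac; move/forallP/(_ c)/implyP : h2; apply.
by apply/forallP => c; apply/implyP; exact: h2.
Qed.

Lemma defpos_increasing s : increasing_on s (defpos s).
Proof. by move=> x y /defposP[_ h] _ /h. Qed.

Lemma Av321P s : reflect (forall i j k : 'I_n, i < j -> j < k -> s j < s i -> s k < s j -> False)
  (s \in Av321 n).
Proof.
rewrite inE; apply: (iffP idP).
  move=> /existsPn h i j k ij jk ji kj; have /existsPn/(_ j)/existsPn/(_ k) := h i.
  by rewrite ij jk ji kj.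
move=> h; apply/existsPn => i; apply/existsPn => j; apply/existsPn => k.
by apply/negP => /and4P[ij jk ji kj]; exact: (h i j k).
Qed.

(** If [s c < s a] for some c > a, then every i < a satisfies [s i < s a], for
    otherwise i, a, c would form a 321 pattern. So s injects the a positions
    before a into the [s a] values below [s a], although [s a < a]. *)
Lemma Av321_defpos s a : s \in Av321 n -> s a < a -> a \in defpos s.
Proof.
move=> /Av321P av saa; apply/defposP; split => // c ac.
rewrite ltnNge leq_eqVlt; apply/negP => /orP[/eqP/val_inj/perm_inj ca|sca].
  by rewrite ca ltnn in ac.
have [/forallP h|] := boolP [forall i : 'I_n, (i < a) ==> (s i <= s a)]; last first.
  move=> /forallPn[i]; rewrite negb_imply -ltnNge => /andP[ia sai].
  exact: (av i a c).
have := @cnt_lt a (ltnW (ltn_ord a)).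
rewrite -(card_imset [set x : 'I_n | x < a]%SET (@perm_inj _ s)) => e.
have : #|(s @: [set x : 'I_n | x < a])%SET| <= #|[set x : 'I_n | x < s a]%SET|.
  apply: subset_leq_card; apply/fintype.subsetP => y /imsetP[x]; rewrite !inE => xa ->.
  have /implyP/(_ xa) := h x; rewrite leq_eqVlt => /orP[/eqP/val_inj/perm_inj xa'|//].
  by rewrite xa' ltnn in xa.
by rewrite e cnt_lt ?(ltnW (ltn_ord _))// leqNgt saa.
Qed.

(** Let i < j lie outside [defpos s] with [s j < s i]. A value below [s j]
    cannot be taken after j, where it would complete a 321 pattern with i and
    j; so the [s j] such values are taken before j and not at i, that is, at
    j - 1 positions at most, although [j <= s j]. *)
Lemma Av321_increasing s : s \in Av321 n -> increasing_on s (~: defpos s)%SET.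
Proof.
move=> av i j; rewrite inE => iA; rewrite inE => jA ij.
have sj : j <= s j by rewrite leqNgt; apply: contra jA; exact: Av321_defpos.
rewrite ltnNge leq_eqVlt; apply/negP => /orP[/eqP/val_inj/perm_inj ji|sji].
  by rewrite ji ltnn in ij.
have [/forallP h|] := boolP [forall c : 'I_n, (s c < s j) ==> (c <= j)]; last first.
  move=> /forallPn[c]; rewrite negb_imply -ltnNge => /andP[scj jc].
  by have /Av321P := av; apply; [exact: ij|exact: jc| |].
have : #|[set y : 'I_n | y < s j]%SET| <= #|([set x : 'I_n | x < j] :\ i)%SET|.
  rewrite -(card_imset ([set x : 'I_n | x < j] :\ i)%SET (@perm_inj _ s)).
  apply: subset_leq_card; apply/fintype.subsetP => y; rewrite inE => ysj.
  apply/imsetP; exists (s^-1 y)%g; last by rewrite permKV.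
  have /implyP := h (s^-1 y)%g; rewrite permKV => /(_ ysj).
  rewrite !inE leq_eqVlt => /orP[/eqP/val_inj e|->].
    by rewrite -e permKV ltnn in ysj.
  rewrite andbT; apply/eqP => e; rewrite -e permKV in sji.
  by have := ltn_trans ysj sji; rewrite ltnn.
rewrite cnt_lt ?(ltnW (ltn_ord _))//.
have := cardsD1 i [set x : 'I_n | x < j]%SET; rewrite cnt_lt ?(ltnW (ltn_ord _))//.
rewrite inE ij => /= e1 e2; have := leq_trans sj e2; rewrite {1}e1 add1n ltnn//.
Qed.

(** s is increasing on [defpos s] and on its complement, hence determined by
    the images of these two sets. *)
Lemma Av321_inj : {in Av321 n &, injective (fun s => (defpos s, defval s))}.
Proof.
move=> s t sA tA [e1 e2]; apply/permP => x.
have [xA|xA] := boolP (x \in defpos s).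
  apply: (increasing_on_inj _ _ _ xA); first exact: defpos_increasing.
    by rewrite e1; exact: defpos_increasing.
  by rewrite -/(defval s) e2 e1.
have imC (u : 'S_n) (C : {set 'I_n}) : (u @: (~: C) = ~: (u @: C))%SET.
  apply/setP => y; rewrite -[y](permKV u) inE !mem_imset ?inE//; exact: perm_inj.
apply: (@increasing_on_inj _ _ (~: defpos s)%SET); last by rewrite inE.
- exact: Av321_increasing.
- by rewrite e1; exact: Av321_increasing.
- by rewrite !imC -/(defval s) e2 e1.
Qed.

Lemma sorted_enum_set A : sorted (fun x y : 'I_n => x < y) (enum A).
Proof.
have tr : transitive (fun x y : 'I_n => x < y) by move=> y x z; exact: ltn_trans.
rewrite /enum_mem; apply: sorted_filter => //.
by rewrite -(sorted_map (e' := ltn) (f := val)) -enumT val_enum_ord iota_ltn_sorted.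
Qed.

(** Match the increasing enumeration of A followed by that of its complement
    with the corresponding enumeration for B. *)
Lemma exists_increasing_perm A B : #|A| = #|B| ->
  exists s : 'S_n, [/\ increasing_on s A, increasing_on s (~: A)%SET & (s @: A = B)%SET].
Proof.
move=> AB.
pose L (C : {set 'I_n}) := enum C ++ enum (~: C)%SET.
have tr : transitive (fun x y : 'I_n => x < y) by move=> y x z; exact: ltn_trans.
have Lu C : uniq (L C).
  rewrite cat_uniq !enum_uniq /= andbT; apply/hasPn => x.
  by rewrite !mem_enum inE.
have Lm C x : x \in L C by rewrite mem_cat !mem_enum inE orbN.
have Ls C : size (L C) = n by rewrite size_cat -!cardE cardsC card_ord.
pose f x := nth x (L B) (index x (L A)).
have fi : injective f.
  move=> x y; rewrite /f => e.
  have ix z : index z (L A) < size (L B) by rewrite (Ls B); have := Lm A z; rewrite -index_mem (Ls A).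
  rewrite (set_nth_default y) // in e.
  move/eqP : e; rewrite nth_uniq// => /eqP e.
  by rewrite -(nth_index x (Lm A x)) e nth_index.
have CB : #|(~: A)%SET| = #|(~: B)%SET| by have := cardsC A; have := cardsC B; rewrite AB => {1}<- /addnI.
have fA x : x \in A -> f x = nth x (enum B) (index x (enum A)).
  move=> xA; rewrite /f index_cat mem_enum xA nth_cat.
  by rewrite -cardE -AB cardE index_mem mem_enum xA.
have fC x : x \notin A -> f x = nth x (enum (~: B)%SET) (index x (enum (~: A)%SET)).
  move=> xA; rewrite /f index_cat mem_enum (negbTE xA) nth_cat.
  by rewrite -cardE -[size _]cardE AB ltnNge leq_addr /= addKn.
have incr (C D : {set 'I_n}) (g : 'I_n -> 'I_n) : #|C| = #|D| ->
    (forall x, x \in C -> g x = nth x (enum D) (index x (enum C))) ->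
    forall x y, x \in C -> y \in C -> x < y -> g x < g y.
  move=> CD gE x y xC yC xy; rewrite !gE// (set_nth_default y); last first.
    by rewrite -cardE -CD cardE index_mem mem_enum.
  have iD z : z \in C -> index z (enum C) \in gtn (size (enum D)).
    by move=> zC; rewrite inE -cardE -CD cardE index_mem mem_enum.
  apply: (sorted_ltn_nth tr y (sorted_enum_set D)) => //; try exact: iD.
  rewrite ltnNge; apply/negP => ix.
  move: ix; rewrite leq_eqVlt => /orP[/eqP ix|ix].
    have := nth_index y (s := enum C) (x := y); rewrite mem_enum => /(_ yC).
    by rewrite ix nth_index ?mem_enum// => e; rewrite e ltnn in xy.
  have iC z : z \in C -> index z (enum C) \in gtn (size (enum C)).
    by move=> zC; rewrite inE index_mem mem_enum.
  have := sorted_ltn_nth tr y (sorted_enum_set C) _ _ (iC _ yC) (iC _ xC) ix.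
  by rewrite !nth_index ?mem_enum// => /(ltn_trans xy); rewrite ltnn.
exists (perm fi); split.
- by move=> x y xA yA xy; rewrite !permE; apply: (incr A B).
- move=> x y xA yA xy; rewrite !permE; apply: (incr (~: A)%SET (~: B)%SET) => //.
  by move=> z; rewrite inE; exact: fC.
- apply/eqP; rewrite eqEcard card_imset ?AB ?leqnn ?andbT; last exact: perm_inj.
  apply/fintype.subsetP => y /imsetP[x xA ->]; rewrite permE fA// -mem_enum mem_nth//.
  by rewrite -cardE -AB cardE index_mem mem_enum.
Qed.

(** Take s increasing from A onto B and from the complement of A onto that of
    B. The comparison of counts says that [s a < a] on A and [x <= s x] off A,
    so that A consists of the strict right-to-left minima. There is no 321
    pattern since two of three positions lie both in A or both outside. *)
Lemma exists_Av321 A B : #|A| = #|B| ->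
  (forall k, k < n -> cnt A k.+1 <= cnt B k) ->
  exists s : 'S_n, [/\ s \in Av321 n, defpos s = A & defval s = B].
Proof.
move=> AB H; have [s [iA iC sAB]] := exists_increasing_perm AB.
have lt a : a \in A -> s a < a.
  move=> aA; rewrite ltnNge; apply/negP => asa.
  have := cnt_mono B asa; rewrite -sAB cnt_imset// sAB.
  have := H a (ltn_ord a); rewrite cntS_in//; lia.
have ge x : x \notin A -> x <= s x.
  move=> xA; rewrite leqNgt; apply/negP => sx.
  have xC : x \in (~: A)%SET by rewrite inE.
  have sC : (s @: (~: A) = ~: B)%SET.
    rewrite -sAB; apply/setP => y.
    by rewrite -[y](permKV s) inE !mem_imset ?inE//; exact: perm_inj.
  have := cnt_mono (~: B)%SET sx; rewrite cntS_in; last by rewrite -sC imset_f.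
  rewrite -sC cnt_imset// sC.
  have := cntC A (ltnW (ltn_ord x)); have := cntC B (ltnW (ltn_ord x)).
  have := H x (ltn_ord x); have := cnt_mono A (leqnSn x); lia.
have dA : defpos s = A.
  apply/setP => a; have [aA|aA] := boolP (a \in A).
    apply/defposP; split; first exact: lt.
    move=> c ac; have [cA|cA] := boolP (c \in A); first exact: iA.
    by have := lt _ aA; have := ge _ cA; lia.
  by apply/negbTE/negP => /defposP[]; have := ge _ aA; lia.
exists s; split => //; last by rewrite /defval dA.
apply/Av321P => i j k ij jk ji kj.
have cmp (x y : 'I_n) : x < y -> s y < s x -> (x \in A) != (y \in A).
  move=> xy yx; apply/eqP => e; have [xA|xA] := boolP (x \in A).
    by have := iA x y xA; rewrite -e xA => /(_ isT xy); lia.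
  by have := iC x y; rewrite !inE -e xA => /(_ isT isT xy); lia.
have := cmp _ _ ij ji; have := cmp _ _ jk kj.
have := cmp _ _ (ltn_trans ij jk) (ltn_trans kj ji).
by case: (i \in A); case: (j \in A); case: (k \in A).
Qed.

Lemma strict_rlmins_fst s : [seq p.1 | p <- strict_rlmins s] = enum (defpos s).
Proof.
rewrite /strict_rlmins filter_map -map_comp.
rewrite (eq_map (g := id)) ?map_id// enumT; apply: eq_filter => a.
by rewrite /= -[RHS]/(a \in defpos s) inE.
Qed.

Lemma strict_rlmins_snd s : [seq p.2 | p <- strict_rlmins s] = map s (enum (defpos s)).
Proof.
rewrite /strict_rlmins filter_map -map_comp.
rewrite (eq_map (g := s))// enumT; congr map; apply: eq_filter => a.
by rewrite /= -[RHS]/(a \in defpos s) inE.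
Qed.

Lemma big_strict_rlmins_fst (R : Type) (idx : R) (op : Monoid.com_law idx) s (F : 'I_n -> R) :
  \big[op/idx]_(k <- [seq p.1 | p <- strict_rlmins s]) F k = \big[op/idx]_(k in defpos s) F k.
Proof. by rewrite strict_rlmins_fst big_enum. Qed.

Lemma big_strict_rlmins_snd (R : Type) (idx : R) (op : Monoid.com_law idx) s (F : 'I_n -> R) :
  \big[op/idx]_(k <- [seq p.2 | p <- strict_rlmins s]) F k = \big[op/idx]_(k in defval s) F k.
Proof.
rewrite strict_rlmins_snd big_map big_enum big_imset//.
by move=> x y _ _; exact: perm_inj.
Qed.

End counting.

(** * Exponential upper bound *)

Section block_integrals.
Variables (R : realType) (n : nat).
Notation leb := (@lebesgue_measure R).
Notation I01 := (`[0 : R, 1 : R]%classic).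
Notation blk k := (@block R n k).
Notation bmeas s := (@block_measure R n s).
Implicit Types (s : seq 'I_n) (k : 'I_n) (f : R -> R).

Lemma sub_blockI k : blk k `<=` I01.
Proof. exact: (@sub_block R n k). Qed.

(** The restriction of Lebesgue measure to a block is carried by this block. *)
Lemma integral_mrestr_block k f (M : R) : measurable_fun I01 f ->
  (forall x, I01 x -> `|f x| <= M) ->
  (\int[mrestr leb (@measurable_block R n k)]_(x in I01) (f x)%:E =
   \int[leb]_(x in blk k) (f x)%:E)%E.
Proof.
move=> mf fM.
pose mb := @measurable_block R n k.
have bI := @sub_blockI k.
have fin : (mrestr leb mb I01 < +oo)%E.
  by rewrite /mrestr (setIidr bI) lebesgue_block ltry.
have fi : (mrestr leb mb).-integrable I01 (EFin \o f).
  apply: measurable_bounded_integrable => //.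
  by exists M; split; [exact: num_real|move=> y My x Ix; apply: le_trans (ltW My); exact: fM].
have nz : mrestr leb mb (I01 `\` blk k) = 0%E.
  by rewrite /mrestr setDE -setIA setICl setI0 measure0.
have mD : measurable (I01 `\` blk k : set (measurableTypeR R)) by apply: measurableD.
have := negligible_integral mD (@measurable_I01 R) fi nz.
rewrite -[LHS]/(\int[mrestr leb mb]_(x in I01) (f x)%:E)%E => ->.
rewrite (_ : I01 `\` (I01 `\` blk k) = blk k); last first.
  by rewrite setDD (setIidr bI).
by apply: eq_measure_integral => A mA AB; rewrite /= /mrestr (setIidl AB).
Qed.

Lemma block_integrable k f (M : R) : measurable_fun I01 f ->
  (forall x, I01 x -> `|f x| <= M) -> leb.-integrable (blk k) (EFin \o f).
Proof.
move=> mf fM; apply: (@leb_integrable_bounded R f M) => //.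
- exact: measurable_block.
- exact: sub_blockI.
- by apply: measurable_funS mf => //; exact: sub_blockI.
- by move=> x /sub_blockI; exact: fM.
Qed.

Lemma Rintegral_block_measure s f (M : R) : measurable_fun I01 f ->
  (forall x, I01 x -> `|f x| <= M) ->
  (\int[bmeas s]_(x in I01) f x)%R =
   \sum_(k <- s) (\int[leb]_(x in blk k) f x)%R.
Proof.
move=> mf fM.
have E : (\int[@block_sum R n s]_(x in I01) (f x)%:E =
   \sum_(k <- s) (\int[leb]_(x in blk k) (f x)%:E))%E.
  elim: s => [|k s IH].
    rewrite big_nil (eq_measure_integral (@mzero _ _ R)) ?integral_measure_zero//.
    by move=> A _ _; rewrite /= /block_sum big_nil.
  rewrite big_cons -IH -(integral_mrestr_block k mf fM).
  rewrite (eq_measure_integral (measure_add (mrestr leb (@measurable_block R n k)) (@block_sum R n s))).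
    apply: integral_measure_add => //.
    - apply: measurable_bounded_integrable => //.
        by rewrite /= /mrestr (setIidr (@sub_blockI k)) lebesgue_block ltry.
      by exists M; split; [exact: num_real|move=> y My x Ix; apply: le_trans (ltW My); exact: fM].
    - apply: measurable_bounded_integrable => //.
        by rewrite ltey_eq block_sum_fin.
      by exists M; split; [exact: num_real|move=> y My x Ix; apply: le_trans (ltW My); exact: fM].
  by move=> A _ _; rewrite /= /msum big_ord_recr big_ord1/= /block_sum big_cons.
apply/eqP; rewrite -eqe -sumEFin; apply/eqP.
rewrite /Rintegral fineK; last first.
  apply: (integrable_fin_num (@measurable_I01 R)).
  exact: (@integrable_bounded R (bmeas s) f M).
rewrite [LHS]E; apply: eq_bigr => k _; rewrite fineK//.
apply: (integrable_fin_num (@measurable_block R n k)).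
exact: (block_integrable k mf fM).
Qed.

(** Convexity of [log1pexp]. With the slope p = exp a / (1 + exp a), the
    inequality [entropy_le] is an equality at f = a. *)
Lemma log1pexp_tangent (a : R) :
  exists p : R, forall z, log1pexp a + p * (z - a) <= log1pexp z.
Proof.
have e0 := expR_gt0 a; set p := expR a / (1 + expR a).
have d0 : 0 < 1 + expR a by lra.
have p01 : 0 <= p <= 1.
  by rewrite divr_ge0 ?(ltW e0) ?(ltW d0)//= ler_pdivrMr// mul1r; lra.
exists p => z.
have := entropy_le z p01.
have -> : entropy p = log1pexp a - p * a.
  rewrite /entropy /xlnx.
  have -> : 1 - p = (1 + expR a)^-1 by rewrite /p; field; lra.
  rewrite lnV ?posrE// /p ln_div ?posrE// expRK /log1pexp.
  by field; lra.
lra.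
Qed.

(** Jensen's inequality for the convex function [log1pexp], by integrating its
    tangent at the mean of f over the block. *)
Lemma Jensen_block k f (M : R) : measurable_fun I01 f ->
  (forall x, I01 x -> `|f x| <= M) ->
  log1pexp (n%:R * (\int[leb]_(x in blk k) f x)%R) <=
  n%:R * (\int[leb]_(x in blk k) log1pexp (f x))%R.
Proof.
move=> mf fM; have n0 := @natr_gt0_ord R n k.
set a := n%:R * _.
have [p h] := log1pexp_tangent a.
have lb : fine (leb (blk k)) = n%:R^-1 by rewrite [X in fine X]lebesgue_block.
have mb := @measurable_block R n k.
have fi := block_integrable k mf fM.
have ci (c : R) : leb.-integrable (blk k) (EFin \o cst c).
  by apply: (@leb_integrable_bounded R _ `|c|) => //; exact: sub_blockI.
have li : leb.-integrable (blk k) (EFin \o (fun x => log1pexp (f x))).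
  apply: (@block_integrable k (fun x => log1pexp (f x)) (ln 2 + M)).
    by apply: measurableT_comp => //; exact: measurable_log1pexp.
  by move=> x Ix; apply: (le_trans (log1pexp_bound _)); rewrite lerD2l fM.
have pfi : leb.-integrable (blk k) (EFin \o (fun x => p * f x)).
  by apply: eq_integrable (integrableZl mb p fi) => // x _; rewrite /= EFinM.
have pi : leb.-integrable (blk k) (EFin \o (fun x => (log1pexp a - p * a) + p * f x)).
  by have := integrableD mb (ci (log1pexp a - p * a)) pfi; exact.
have : (\int[leb]_(x in blk k) ((log1pexp a - p * a) + p * f x))%R <=
    (\int[leb]_(x in blk k) log1pexp (f x))%R.
  by apply: le_Rintegral => // x _; have := h (f x); lra.
rewrite RintegralD//; last exact: ci.
rewrite Rintegral_cst// RintegralZl// lb.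
set u := Rintegral _ _ _ in a h pi *; set v := Rintegral _ _ _.
move=> /(ler_wpM2l (ltW n0)); apply: le_trans.
have -> : n%:R * ((log1pexp a - p * a) / n%:R + p * u) =
   (log1pexp a - p * a) + p * (n%:R * u) by field; lra.
by rewrite -/a; lra.
Qed.

(** The blocks overlap at their end points, so the sum of the integrals over
    all blocks is treated as the integral against the measure of the full
    list of blocks, whose density is at most 1. *)
Lemma sum_log1pexp_le f (M : R) : measurable_fun I01 f ->
  (forall x, I01 x -> `|f x| <= M) ->
  \sum_k log1pexp (n%:R * (\int[leb]_(x in blk k) f x)%R) <=
  n%:R * (\int[leb]_(x in I01) log1pexp (f x))%R.
Proof.
move=> mf fM.
have mL : measurable_fun I01 (fun x => log1pexp (f x)).
  by apply: measurableT_comp => //; exact: measurable_log1pexp.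
have LM x : I01 x -> `|log1pexp (f x)| <= ln 2 + M.
  by move=> Ix; apply: (le_trans (log1pexp_bound _)); rewrite lerD2l fM.
apply: (@le_trans _ _ (n%:R * (\int[bmeas (enum 'I_n)]_(x in I01) log1pexp (f x))%R)).
  rewrite (Rintegral_block_measure _ mL LM) mulr_sumr big_enum/=.
  by apply: ler_sum => k _; exact: Jensen_block mf fM.
apply: ler_wpM2l => //.
have lb : le_leb (bmeas (enum 'I_n)) by apply: block_measure_le; exact: enum_uniq.
rewrite (dens_Rintegral lb mL LM).
have L0 x : 0 <= log1pexp (f x) by rewrite /log1pexp ln_ge0// lerDl expR_ge0.
have d01 := dens01 (bmeas (enum 'I_n)).
apply: le_Rintegral => //.
- apply: (@leb_integrable_bounded R _ (ln 2 + M)) => //.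
    by apply: measurable_funM => //; apply: measurable_funTS; exact: measurable_dens.
  move=> x Ix; have := LM x Ix; have /andP[d0 d1] := d01 x; have := L0 x.
  rewrite normrM (ger0_norm d0) => l0; rewrite ger0_norm// => l1.
  by apply: le_trans l1; rewrite ler_piMr.
- exact: (@leb_integrable_bounded R _ (ln 2 + M)).
- by move=> x _; have /andP[d0 d1] := d01 x; rewrite ler_piMr.
Qed.

(** Expanding the product of the factors 1 + exp (c k) gives one term for each
    set of indices. *)
Lemma sum_exp_sets (c : 'I_n -> R) :
  \sum_(A : {set 'I_n}) expR (\sum_(k in A) c k) = expR (\sum_k log1pexp (c k)).
Proof.
rewrite expR_sum; under [RHS]eq_bigr => k _.
  rewrite /log1pexp lnK; last by rewrite posrE addr_gt0// expR_gt0.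
  rewrite addrC; over.
rewrite bigA_distr; apply: eq_bigr => A _.
by rewrite expR_sum big_mkcond.
Qed.

End block_integrals.

Section upper_count.
Variables (R : realType) (n : nat).
Notation leb := (@lebesgue_measure R).
Notation I01 := (`[0 : R, 1 : R]%classic).

Lemma Rintegral_pi1 (s : 'S_n) (f : R -> R) (M : R) : measurable_fun I01 f ->
  (forall x, I01 x -> `|f x| <= M) ->
  (\int[pi1 R s]_(x in I01) f x)%R =
  \sum_(k in defpos s) (\int[leb]_(x in @block R n k) f x)%R.
Proof.
by move=> mf fM; rewrite /pi1 (Rintegral_block_measure _ mf fM) big_strict_rlmins_fst.
Qed.

Lemma Rintegral_pi2 (s : 'S_n) (f : R -> R) (M : R) : measurable_fun I01 f ->
  (forall x, I01 x -> `|f x| <= M) ->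
  (\int[pi2 R s]_(x in I01) f x)%R =
  \sum_(k in defval s) (\int[leb]_(x in @block R n k) f x)%R.
Proof.
by move=> mf fM; rewrite /pi2 (Rintegral_block_measure _ mf fM) big_strict_rlmins_snd.
Qed.

Lemma ler_sum_inj (T U : finType) (S : {set T}) (h : T -> U) (F : U -> R) :
  {in S &, injective h} -> (forall u, 0 <= F u) ->
  \sum_(s in S) F (h s) <= \sum_u F u.
Proof.
move=> hi F0; rewrite -(big_imset _ hi) [leRHS](bigID (mem (h @: S)%SET))/=.
by rewrite lerDl sumr_ge0.
Qed.

(** Chernoff's bound. The exponential of n times the linear part of [Psi f g]
    is summed over all pairs of sets: [sum_exp_sets] factorises this sum and
    [sum_log1pexp_le] estimates it. Each permutation counted contributes a
    term bounded below in terms of a, and distinct ones have distinct terms. *)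
Lemma card_Psi_le (f g : test_fun R) (a : R) :
  #|[set s in Av321 n | a <= Psi f g (pi_pair R s)]%SET|%:R <=
  expR (n%:R * (2 * ln 2 - a)).
Proof.
have [Mf fM] := test_bounded f; have [Mg gM] := test_bounded g.
have mf := test_measurable f; have mg := test_measurable g.
pose c (h : R -> R) (k : 'I_n) := n%:R * (\int[leb]_(x in @block R n k) h x)%R.
pose F (u : {set 'I_n} * {set 'I_n}) :=
  expR (\sum_(k in u.1) c (sval f) k) * expR (\sum_(k in u.2) c (sval g) k).
pose L (h : R -> R) := (\int[leb]_(x in I01) log1pexp (h x))%R.
set S := [set s in Av321 n | _]%SET.
have hi : {in S &, injective (fun s => (defpos s, defval s))}.
  move=> s t; rewrite !inE => /andP[sA _] /andP[tA _].
  by apply: Av321_inj; rewrite inE.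
have F0 u : 0 <= F u by rewrite mulr_ge0// expR_ge0.
have := ler_sum_inj hi F0.
have sF : \sum_u F u <= expR (n%:R * (L (sval f) + L (sval g))).
  have -> : \sum_u F u = (\sum_(A : {set 'I_n}) expR (\sum_(k in A) c (sval f) k)) *
      (\sum_(A : {set 'I_n}) expR (\sum_(k in A) c (sval g) k)).
    by rewrite big_distrlr/= pair_big.
  rewrite !sum_exp_sets -expRD ler_expR mulrDr lerD//.
    exact: sum_log1pexp_le mf fM.
  exact: sum_log1pexp_le mg gM.
move=> /le_trans/(_ sF).
have FS : #|S|%:R * expR (n%:R * (a - 2 * ln 2 + L (sval f) + L (sval g))) <=
    \sum_(s in S) F (defpos s, defval s).
  rewrite mulr_natl -sumr_const; apply: ler_sum => s; rewrite inE => /andP[_].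
  rewrite /F /= -expRD ler_expR -!mulr_sumr -mulrDr /Psi /Jdual /=.
  rewrite (Rintegral_pi1 s mf fM) (Rintegral_pi2 s mg gM) -/(L (sval f)) -/(L (sval g)).
  move=> h; apply: ler_wpM2l => //; move: h.
  move: (\sum_(k in defpos s) _) (\sum_(k in defval s) _) (L _) (L _) => x y u v; lra.
move=> /(le_trans FS); rewrite -ler_pdivlMr ?expR_gt0// -expRN -expRD.
move: (L (sval f)) (L (sval g)) => u v; move=> /le_trans; apply.
by rewrite ler_expR; lra.
Qed.

End upper_count.

(** * Permutations built layer by layer *)

Section encoding.
Local Open Scope nat_scope.
Variables (n m L sft : nat).
Hypothesis L0 : 0 < L.
Hypothesis sz : (m + sft) * L <= n.
Implicit Types (U : {ffun 'I_m -> {set 'I_L}}).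

Lemma slot_lt (j : 'I_m) (u : 'I_L) : (j + sft) * L + u < (m + sft) * L.
Proof.
have := ltn_ord j; have := ltn_ord u; move: (val j) (val u) => a b bL am.
have : (a + sft).+1 * L <= (m + sft) * L by rewrite leq_mul2r -addSn leq_add2r am orbT.
rewrite mulSn; lia.
Qed.

Lemma slot_subproof (j : 'I_m) (u : 'I_L) : (j + sft) * L + u < n.
Proof. exact: leq_trans (slot_lt j u) sz. Qed.

(** The u-th index of the j-th layer, where the layers have length L and are
    shifted to the right by [sft] layers: by one layer for the positions of the
    right-to-left minima, by none for their values. *)
Definition slot (j : 'I_m) (u : 'I_L) : 'I_n := Ordinal (slot_subproof j u).

Lemma slot_inj (j j' : 'I_m) (u u' : 'I_L) : slot j u = slot j' u' -> j = j' /\ u = u'.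
Proof.
move=> /(congr1 val) /= e.
have := congr1 (modn^~ L) e; have := congr1 (divn^~ L) e.
rewrite /= !divnMDl// !(divn_small (ltn_ord _)) !addn0 !modnMDl !(modn_small (ltn_ord _)).
by move=> /addIn h1 h2; split; apply: val_inj.
Qed.

(** The set whose trace on the j-th layer is a copy of [U j]. *)
Definition encode U : {set 'I_n} := [set x | [exists j, exists u, (u \in U j) && (x == slot j u)]]%SET.

Lemma slot_encode U j u : (slot j u \in encode U) = (u \in U j).
Proof.
rewrite inE; apply/existsP/idP.
  by move=> [j' /existsP[u' /andP[u'U /eqP/slot_inj[-> ->]]]].
by move=> uU; exists j; apply/existsP; exists u; rewrite uU eqxx.
Qed.

Lemma encodeP U x : x \in encode U -> exists j u, u \in U j /\ x = slot j u.
Proof.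
by rewrite inE => /existsP[j /existsP[u /andP[uU /eqP->]]]; exists j, u.
Qed.

Lemma encode_inj : injective encode.
Proof.
move=> U V e; apply/ffunP => j; apply/setP => u.
by rewrite -!slot_encode e.
Qed.

Lemma mem_cnt (A : {set 'I_n}) k x :
  (x \in [set x in A | x < k]%SET) = (x \in A) && (x < k).
Proof. by rewrite finset.in_set. Qed.

Lemma cnt_encode U j : j <= m ->
  cnt (encode U) ((j + sft) * L) = \sum_(i < m | i < j) #|U i|.
Proof.
elim: j => [_|j IH jm].
  rewrite add0n big_pred0//; apply/eqP; rewrite cards_eq0; apply/eqP/setP => x.
  rewrite mem_cnt finset.in_set0; apply/negbTE/negP => /andP[/encodeP[j [u [_ ->]]]] /=.
  by rewrite ltnNge mulnDl -addnA addnCA leq_addr.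
pose j' := Ordinal jm.
rewrite (bigD1 j')//= (eq_bigl (fun i : 'I_m => i < j)); last first.
  by move=> i; rewrite ltnS ltn_neqAle andbC.
rewrite -IH; last exact: ltnW.
rewrite -(card_imset (mem (U j')) (f := slot j')); last by move=> u v /slot_inj[].
rewrite /cnt [RHS]addnC -[LHS](cardsID [set x : 'I_n | x < (j + sft) * L]%SET).
congr (_ + _); apply: eq_card => x.
  rewrite finset.in_setI !mem_cnt finset.in_set -andbA; congr andb.
  by have := leq_mul2r L (j + sft) (j.+1 + sft); rewrite addSn leqnSn orbT; lia.
rewrite finset.in_setD mem_cnt finset.in_set -leqNgt; apply/idP/imsetP.
  move=> /andP[jx /andP[/encodeP[i [u [uU e]]] xj]].
  suff -> : j' = i by exists u.
  move: jx xj; rewrite e /= => jx xj; apply: val_inj => /=; apply/eqP; rewrite eqn_leq.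
  have := ltn_ord u => uL.
  have h1 : (j + sft) * L < (i + sft).+1 * L by rewrite mulSn; lia.
  have h2 : (i + sft) * L < (j.+1 + sft) * L by lia.
  by move: h1 h2; rewrite !ltn_mul2r L0 /=; lia.
move=> [u uU ->]; rewrite slot_encode uU /= leq_addr /= addSn mulSn addnC ltn_add2r.
exact: ltn_ord.
Qed.

Lemma cnt_encode_ge U k : (m + sft) * L <= k -> cnt (encode U) k = \sum_(i < m) #|U i|.
Proof.
move=> kn; rewrite -[RHS](eq_bigl _ _ (fun i : 'I_m => ltn_ord i)) -cnt_encode//.
apply: eq_card => x; rewrite !mem_cnt; apply: andb_id2l => /encodeP[j [u [_ ->]]] /=.
by rewrite slot_lt (leq_trans (slot_lt j u) kn).
Qed.

End encoding.

Section families.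
Local Open Scope nat_scope.
Variables (n m L : nat) (S1 S2 : nat -> nat).
Hypothesis L0 : 0 < L.
Hypothesis sz : (m + 1) * L <= n.
Hypothesis S10 : S1 0 = 0.
Hypothesis S20 : S2 0 = 0.
Hypothesis S1n : forall j, S1 j <= S1 j.+1.
Hypothesis S2n : forall j, S2 j <= S2 j.+1.
Hypothesis S12 : forall j, j <= m -> S1 j <= S2 j.
Hypothesis S12m : S1 m = S2 m.

(** [S j] is the prescribed number of points in the first j layers. *)
Definition layers (S : nat -> nat) : {set {ffun 'I_m -> {set 'I_L}}} :=
  [set U : {ffun 'I_m -> {set 'I_L}} | [forall j : 'I_m, #|U j| == S j.+1 - S j]]%SET.

Lemma card_layers S : #|layers S| = \prod_(j < m) 'C(L, S j.+1 - S j).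
Proof.
have -> : #|layers S| = #|(family (fun j : 'I_m => [pred V : {set 'I_L} | #|V| == S j.+1 - S j]))|.
  apply: eq_card => U; rewrite finset.in_set; apply/forallP/familyP => h j; exact: h.
rewrite card_family foldrE big_map big_enum /=; apply: eq_bigr => j _.
by rewrite -[X in 'C(X, _)](card_ord L) -card_draws; apply: eq_card => V; rewrite finset.in_set.
Qed.

Lemma sum_layers S U j : (forall j, S j <= S j.+1) -> S 0 = 0 -> U \in layers S -> j <= m ->
  \sum_(i < m | i < j) #|U i| = S j.
Proof.
move=> Sn S0; rewrite finset.in_set => /forallP h jm.
rewrite (eq_bigr (fun i : 'I_m => S i.+1 - S i)) => [|i _]; last exact/eqP.
rewrite -(big_ord_widen m (fun i => S i.+1 - S i) jm).
elim: j {jm} => [|j IH]; first by rewrite big_ord0.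
by rewrite big_ord_recr/= IH subnKC.
Qed.

Lemma sz0 : (m + 0) * L <= n.
Proof. by apply: leq_trans sz; rewrite leq_mul2r leq_add2l orbT. Qed.

Definition encA (U : {ffun 'I_m -> {set 'I_L}}) : {set 'I_n} := encode L0 sz U.
Definition encB (U : {ffun 'I_m -> {set 'I_L}}) : {set 'I_n} := encode L0 sz0 U.

(** Let q be the layer of k. Because of the shift, at most the first q layers
    of U contribute to the count of A below k + 1, that is S1 q points, while
    the first q layers of V already contribute S2 q >= S1 q points to the count
    of B below k. This is the condition of [exists_Av321]. *)
Lemma layers_Av321 U V : U \in layers S1 -> V \in layers S2 ->
  exists s : 'S_n, [/\ s \in Av321 n, defpos s = encA U & defval s = encB V].
Proof.
move=> hU hV.
have cA j : j <= m -> cnt (encA U) ((j + 1) * L) = S1 j.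
  by move=> jm; rewrite cnt_encode// (sum_layers S1n S10 hU).
have cB j : j <= m -> cnt (encB V) (j * L) = S2 j.
  by move=> jm; rewrite -[in LHS](addn0 j) cnt_encode// (sum_layers S2n S20 hV).
have tA k : (m + 1) * L <= k -> cnt (encA U) k = S1 m.
  move=> mk; rewrite cnt_encode_ge// -(sum_layers S1n S10 hU (leqnn m)).
  by apply: eq_bigl => i; rewrite ltn_ord.
have tB k : m * L <= k -> cnt (encB V) k = S2 m.
  move=> mk; rewrite cnt_encode_ge// ?addn0// -(sum_layers S2n S20 hV (leqnn m)).
  by apply: eq_bigl => i; rewrite ltn_ord.
apply: exists_Av321.
  rewrite -!cnt_full tA// tB; last by have := sz0; rewrite addn0.
  exact: S12m.
move=> k kn; set q := k %/ L.
have kq : k.+1 <= (q + 1) * L by rewrite addn1; exact: ltn_ceil.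
have qk : q * L <= k by exact: leq_trunc_div.
have [qm|mq] := leqP q m.
  apply: leq_trans (cnt_mono _ kq) _; rewrite cA//.
  by apply: leq_trans (cnt_mono _ qk); rewrite cB// S12.
have mk : m * L <= k by apply: leq_trans qk; rewrite leq_mul2r (ltnW mq) orbT.
have Mk : (m + 1) * L <= k.+1.
  by apply: leqW; apply: leq_trans qk; rewrite leq_mul2r addn1 mq orbT.
by rewrite tA// tB// S12m.
Qed.

(** Different families U and V give different pairs of sets, hence different
    permutations. *)
Lemma card_layers_le (Q : pred 'S_n) :
  (forall s U V, s \in Av321 n -> U \in layers S1 -> V \in layers S2 ->
     defpos s = encA U -> defval s = encB V -> Q s) ->
  (\prod_(j < m) 'C(L, S1 j.+1 - S1 j)) * (\prod_(j < m) 'C(L, S2 j.+1 - S2 j)) <=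
  #|[set s in Av321 n | Q s]%SET|.
Proof.
move=> hQ; rewrite -!card_layers -cardsX.
pose e (UV : {ffun 'I_m -> {set 'I_L}} * {ffun 'I_m -> {set 'I_L}}) := (encA UV.1, encB UV.2).
have ei : injective e.
  by move=> [U V] [U' V'] [/encode_inj -> /encode_inj ->].
rewrite -(card_imset _ ei).
apply: leq_trans (leq_imset_card (fun s : 'S_n => (defpos s, defval s)) _).
apply: subset_leq_card; apply/fintype.subsetP => x /imsetP[[U V]].
rewrite finset.in_setX /= => /andP[hU hV] ->.
have [s [sA sU sV]] := layers_Av321 hU hV.
apply/imsetP; exists s; last by rewrite /e /= sU sV.
by rewrite finset.in_set sA /=; exact: (hQ s U V).
Qed.

End families.

(** * Rounding a distribution function *)

Section rounding.
Variable R : realType.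

Definition is_dist (G : R -> R) := G 0 = 0 /\
  forall a b, 0 <= a -> a <= b -> b <= 1 -> 0 <= G b - G a <= b - a.

(** Bounding the argument by 1 makes the sequence constant from j = m on, so
    that it is nondecreasing without restriction on j. *)
Definition rounded (G : R -> R) (m L j : nat) : nat :=
  Num.truncn ((m * L)%:R * G (Num.min 1 (j%:R / m%:R))).

Lemma is_dist01 G x : is_dist G -> 0 <= x <= 1 -> 0 <= G x <= x.
Proof.
by move=> [G0 h] /andP[x0 x1]; have := h 0 x (lexx _) x0 x1; rewrite G0 !subr0.
Qed.

Lemma grid01 (m j : nat) : 0 <= (Num.min 1 (j%:R / m%:R) : R) <= 1.
Proof. by rewrite le_min ler01 divr_ge0//= ge_min lexx. Qed.

Lemma gridE (m j : nat) : (0 < m)%N -> (j <= m)%N ->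
  Num.min 1 (j%:R / m%:R) = j%:R / m%:R :> R.
Proof.
by move=> m0 jm; apply/min_idPr; rewrite ler_pdivrMr ?ltr0n// mul1r ler_nat.
Qed.

Lemma rounded_itv G m L j : is_dist G ->
  (rounded G m L j)%:R <= (m * L)%:R * G (Num.min 1 (j%:R / m%:R)) < (rounded G m L j)%:R + 1.
Proof.
move=> dG; have /andP[h _] := is_dist01 dG (grid01 m j).
by have := truncn_itv (mulr_ge0 (ler0n R (m * L)) h); rewrite -natr1.
Qed.

Lemma rounded0 G m L : is_dist G -> rounded G m L 0 = 0%N.
Proof.
move=> [G0 _]; rewrite /rounded mul0r.
by have /min_idPr -> := @ler01 R; rewrite G0 mulr0 truncn0.
Qed.

Lemma grid_mono (m j : nat) : Num.min 1 (j%:R / m%:R) <= Num.min 1 (j.+1%:R / m%:R) :> R.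
Proof.
rewrite le_min !ge_min lexx /= ; apply/orP; right.
by apply: ler_wpM2r => //; rewrite ler_nat.
Qed.

Lemma rounded_mono G m L j : is_dist G -> (rounded G m L j <= rounded G m L j.+1)%N.
Proof.
move=> dG; apply: le_truncn; apply: ler_wpM2l => //.
rewrite -subr_ge0; have [_ h] := dG.
have /andP[a0 a1] := grid01 m j; have /andP[b0 b1] := grid01 m j.+1.
by have /andP[] := h _ _ a0 (grid_mono m j) b1.
Qed.

Lemma rounded_le G1 G2 m L j : (forall x, 0 <= x <= 1 -> G1 x <= G2 x) ->
  (rounded G1 m L j <= rounded G2 m L j)%N.
Proof.
by move=> h; apply: le_truncn; apply: ler_wpM2l => //; apply: h; exact: grid01.
Qed.

Lemma rounded_incr G m L j : is_dist G -> (0 < m)%N -> (j < m)%N ->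
  `|(rounded G m L j.+1 - rounded G m L j)%:R -
    L%:R * (m%:R * (G (j.+1%:R / m%:R) - G (j%:R / m%:R)))| <= 1.
Proof.
move=> dG m0 jm; rewrite natrB; last exact: rounded_mono.
have := rounded_itv m L j dG; have := rounded_itv m L j.+1 dG.
rewrite !gridE//; last exact: ltnW.
rewrite natrM ler_norml; nra.
Qed.

(** The exact increment is at most L by the Lipschitz bound; rounding down at
    both ends keeps it below L + 1. *)
Lemma rounded_incr_le G m L j : is_dist G -> (0 < m)%N -> (j < m)%N ->
  (rounded G m L j.+1 - rounded G m L j <= L)%N.
Proof.
move=> dG m0 jm; rewrite leq_subLR -ltnS -(ltr_nat R) -natr1 natrD.
have := rounded_itv m L j dG; have := rounded_itv m L j.+1 dG.
rewrite !gridE//; last exact: ltnW.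
have m0' : 0 < m%:R :> R by rewrite ltr0n.
have /andP[_] : 0 <= G (j.+1%:R / m%:R) - G (j%:R / m%:R) <= j.+1%:R / m%:R - j%:R / m%:R.
  apply: dG.2; rewrite ?divr_ge0// ?ler_pdivrMr// ?mul1r ?ler_nat//.
  by rewrite divfK ?gt_eqF// ler_nat.
have -> : j.+1%:R / m%:R - j%:R / m%:R = m%:R^-1 :> R.
  by rewrite -mulrBl -natr1 addrAC subrr add0r mul1r.
move=> h.
have : (m * L)%:R * (G (j.+1%:R / m%:R) - G (j%:R / m%:R)) <= L%:R :> R.
  apply: (le_trans (ler_wpM2l (ler0n R (m * L)) h)).
  by rewrite natrM mulrAC divff ?mul1r// gt_eqF.
rewrite natrM -natr1; nra.
Qed.

Lemma is_dist_lip G x y : is_dist G -> 0 <= x <= 1 -> 0 <= y <= 1 -> `|G x - G y| <= `|x - y|.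
Proof.
move=> [_ h] /andP[x0 x1] /andP[y0 y1].
have [xy|/ltW yx] := leP x y.
  have := h _ _ x0 xy y1 => /andP[? ?].
  by rewrite distrC (distrC x) !ger0_norm// subr_ge0.
by have := h _ _ y0 yx x1 => /andP[? ?]; rewrite !ger0_norm// subr_ge0.
Qed.

(** Let D = n - m * L, which bounds both the length of a layer and the unused
    remainder. Up to D, the count below k is the count at the end of a layer,
    which is prescribed; the other approximations are of order D as well since
    G is 1-Lipschitz. *)
Lemma cnt_close n (C : {set 'I_n}) G m L sft : is_dist G -> (0 < m)%N -> (0 < L)%N ->
  ((m + 1) * L <= n)%N -> (sft <= 1)%N ->
  (forall j, (j <= m)%N -> cnt C ((j + sft) * L)%N = rounded G m L j) ->
  forall k, (k <= n)%N ->
  `|(cnt C k)%:R - n%:R * G (k%:R / n%:R)| <= 4 * (n%:R - (m * L)%:R) + 1 :> R.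
Proof.
move=> dG m0 L0 mLn s1 hC k kn.
have n0 : (0 < n)%N by apply: leq_trans mLn; rewrite muln_gt0 L0 addn1.
have n0' : 0 < n%:R :> R by rewrite ltr0n.
have m0' : 0 < m%:R :> R by rewrite ltr0n.
pose j := minn (k %/ L) m.
have jm : (j <= m)%N by exact: geq_minr.
pose D := (n - m * L)%N.
have DE : D%:R = n%:R - (m * L)%:R :> R.
  by rewrite natrB//; apply: leq_trans mLn; rewrite leq_mul2r leq_addr orbT.
have LD : (L <= D)%N by move: mLn; rewrite mulnDl mul1n /D; lia.
have [h3 [h4 h5]] : (k <= j * L + D)%N /\ (j * L <= k)%N /\ (k < j * L + L \/ (j + 1) * L <= k)%N.
  have kL := leq_trunc_div k L; have kU := ltn_ceil k L0; rewrite /j.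
  have [qm|mq] := leqP (k %/ L) m.
    by move: kU; rewrite mulSn; lia.
  have : (m.+1 * L <= k %/ L * L)%N by rewrite leq_mul2r mq orbT.
  by move: kn mLn; rewrite mulSn mulnDl mul1n /D; lia.
have [h1 h2] : (k <= (j + sft) * L + D)%N /\ ((j + sft) * L <= k + D)%N.
  by case: sft s1 {hC} => [|[|//]] _; rewrite mulnDl ?mul0n ?mul1n; lia.
rewrite -DE.
(* The total error splits into D for the count, 1 for the rounding, D for
   replacing m * L by n, and 2 * D for replacing j / m by k / n. *)
have e1 : `|(cnt C k)%:R - (rounded G m L j)%:R| <= D%:R :> R.
  rewrite -hC//; have [ab|/ltnW ba] := leqP k ((j + sft) * L).
    have a1 := cnt_mono C ab; have a2 := cnt_lip C ab.
    by rewrite distrC -natrB// normr_nat ler_nat; lia.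
  have a1 := cnt_mono C ba; have a2 := cnt_lip C ba.
  by rewrite -natrB// normr_nat ler_nat; lia.
have e2 := rounded_itv m L j dG; rewrite gridE// in e2.
have jm01 : 0 <= (j%:R / m%:R : R) <= 1.
  by rewrite divr_ge0//= ler_pdivrMr// mul1r ler_nat.
have kn01 : 0 <= (k%:R / n%:R : R) <= 1.
  by rewrite divr_ge0//= ler_pdivrMr// mul1r ler_nat.
have /andP[g0 g1] := is_dist01 dG jm01.
have e3 : 0 <= n%:R * G (j%:R / m%:R) - (m * L)%:R * G (j%:R / m%:R) <= D%:R.
  have D0 : 0 <= D%:R :> R by [].
  rewrite -mulrBl -DE mulr_ge0//= ler_piMr//; move/andP: jm01 => [_ h]; lra.
have e4 : n%:R * `|G (j%:R / m%:R) - G (k%:R / n%:R)| <= 2 * D%:R.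
  apply: (@le_trans _ _ (n%:R * `|j%:R / m%:R - k%:R / n%:R|)).
    by apply: ler_wpM2l => //; exact: is_dist_lip.
  rewrite -{1}(ger0_norm (ltW n0')) -normrM mulrBr.
  have -> : n%:R * (k%:R / n%:R) = k%:R :> R by field; lra.
  have -> : n%:R * (j%:R / m%:R) = (j * L)%:R + D%:R * (j%:R / m%:R) :> R.
    by rewrite DE !natrM; field; lra.
  have D0 : 0 <= D%:R :> R by [].
  have : D%:R * (j%:R / m%:R) <= D%:R :> R by rewrite ler_piMr//; case/andP: jm01.
  have : 0 <= D%:R * (j%:R / m%:R) :> R by rewrite mulr_ge0//; case/andP: jm01.
  move: h3 h4; rewrite -!(ler_nat R) natrD ler_norml; lra.
have e5 : `|n%:R * G (j%:R / m%:R) - n%:R * G (k%:R / n%:R)| <= 2 * D%:R.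
  by rewrite -mulrBr normrM (ger0_norm (ltW n0')).
move: e1 e2 e3 e5; rewrite !ler_norml; lra.
Qed.

End rounding.

(** * Permutations close to given distribution functions *)

Section block_dist.
Variables (R : realType) (n : nat).
Notation leb := (@lebesgue_measure R).
Notation I01 := (`[0 : R, 1 : R]%classic).
Hypothesis n0 : (0 < n)%N.

Lemma lebesgue_grid_block (k : nat) (i : 'I_n) :
  leb (`[0, k%:R / n%:R]%classic `&` @block R n i) = (if (i < k)%N then n%:R^-1 else 0)%:E.
Proof.
have N0 := @natr_gt0_ord R n i.
case: ifP => ik.
  rewrite (setIidr _); first exact: lebesgue_block.
  move=> x; rewrite /block /= !in_itv/= => /andP[ix xi]; apply/andP; split.
    by apply: le_trans ix; rewrite divr_ge0.
  by apply: (le_trans xi); apply: ler_wpM2r; rewrite ?invr_ge0// ler_nat.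
apply/eqP; rewrite eq_le measure_ge0 andbT.
rewrite -[leRHS](lebesgue_measure_set1 (k%:R / n%:R)).
apply: le_measure; rewrite ?inE//.
  by apply: measurableI => //; exact: measurable_itv.
move=> x [] /=; rewrite /block /= !in_itv/= => /andP[_ xk] /andP[ix _].
apply/eqP; rewrite eq_le xk /=; apply: le_trans ix.
by apply: ler_wpM2r; rewrite ?invr_ge0// ler_nat leqNgt ik.
Qed.

Lemma dist_block (s : seq 'I_n) (C : {set 'I_n}) (k : nat) :
  (forall F : 'I_n -> \bar R, (\sum_(i <- s) F i = \sum_(i in C) F i)%E) ->
  dist (@block_measure R n s) (k%:R / n%:R) = (cnt C k)%:R / n%:R.
Proof.
move=> hs; apply/eqP; rewrite -eqe distE /= /block_sum hs.
rewrite (eq_bigr (fun i : 'I_n => (if (i < k)%N then n%:R^-1 else 0)%:E)) => [|i _]; last first.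
  exact: lebesgue_grid_block.
rewrite sumEFin eqe -big_mkcondr /= sumr_const; apply/eqP; rewrite -[LHS]mulr_natl.
by congr (_%:R * _); apply: eq_card => x; rewrite [RHS]inE.
Qed.

Lemma dist_pi1 (s : 'S_n) (k : nat) :
  dist (pi1 R s) (k%:R / n%:R) = (cnt (defpos s) k)%:R / n%:R.
Proof. by apply: dist_block => F; rewrite big_strict_rlmins_fst. Qed.

Lemma dist_pi2 (s : 'S_n) (k : nat) :
  dist (pi2 R s) (k%:R / n%:R) = (cnt (defval s) k)%:R / n%:R.
Proof. by apply: dist_block => F; rewrite big_strict_rlmins_snd. Qed.

Lemma is_dist_dist (mu : unit_measure R) : le_leb mu -> is_dist (dist mu).
Proof.
move=> h; split; first exact: dist0.
by move=> a b a0 ab b1; rewrite subr_ge0 dist_mono ?a0//= dist_lip// a0.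
Qed.

(** Both functions are 1-Lipschitz and grid points are at distance 1 / n. *)
Lemma dist_close (mu : unit_measure R) (G : R -> R) (e : R) : le_leb mu -> is_dist G ->
  (forall k, (k <= n)%N -> `|n%:R * dist mu (k%:R / n%:R) - n%:R * G (k%:R / n%:R)| <= e) ->
  forall x, 0 <= x <= 1 -> `|dist mu x - G x| <= (e + 2) / n%:R.
Proof.
move=> h dG hk x /[dup] x01 /andP[x0 x1].
have n0' : 0 < n%:R :> R by rewrite ltr0n.
have nx : 0 <= n%:R * x by rewrite mulr_ge0// ltW.
pose k := Num.truncn (n%:R * x).
have /andP[k1 k2] := truncn_itv nx; rewrite -/k in k1 k2.
have kn : (k <= n)%N.
  by rewrite -(ler_nat R); apply: (le_trans k1); rewrite ler_piMr// ltW.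
have y01 : 0 <= (k%:R / n%:R : R) <= 1.
  by rewrite divr_ge0//= ler_pdivrMr// mul1r ler_nat.
have xy : `|x - k%:R / n%:R| <= n%:R^-1.
  rewrite ger0_norm; last by rewrite subr_ge0 ler_pdivrMr// mulrC.
  rewrite lerBlDr -[X in X + _]mul1r -mulrDl ler_pdivlMr// addrC natr1 mulrC.
  exact: ltW.
have a1 := le_trans (is_dist_lip (is_dist_dist h) x01 y01) xy.
have a2 := le_trans (is_dist_lip dG x01 y01) xy.
have a3 := hk k kn.
rewrite -mulrBr normrM (ger0_norm (ltW n0')) mulrC -ler_pdivlMr// in a3.
rewrite mulrDl; move: a1 a2 a3; move: (n%:R^-1) => v.
rewrite !ler_norml; lra.
Qed.

End block_dist.

Section core.
Variable R : realType.

Definition close_to (G1 G2 : R -> R) (de : R) (n : nat) (s : 'S_n) : Prop :=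
  forall x, 0 <= x <= 1 -> `|dist (pi1 R s) x - G1 x| <= de /\ `|dist (pi2 R s) x - G2 x| <= de.

(** The properties of the distribution functions of a point of the domain. *)
Definition dist_pair (G1 G2 : R -> R) := [/\ is_dist G1, is_dist G2, G1 1 = G2 1 &
  forall x, 0 <= x <= 1 -> G1 x <= G2 x].

(** The mean density on the j-th of m cells. *)
Definition slope (G : R -> R) (m j : nat) : R :=
  m%:R * (G (j.+1%:R / m%:R) - G (j%:R / m%:R)).

Lemma slope01 G m j : is_dist G -> (0 < m)%N -> (j < m)%N -> 0 <= slope G m j <= 1.
Proof.
move=> dG m0 jm; have m0' : 0 < m%:R :> R by rewrite ltr0n.
have : 0 <= G (j.+1%:R / m%:R) - G (j%:R / m%:R) <= j.+1%:R / m%:R - j%:R / m%:R.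
  apply: dG.2; first by rewrite divr_ge0.
    by apply: ler_wpM2r; rewrite ?invr_ge0// ler_nat.
  by rewrite ler_pdivrMr// mul1r ler_nat.
have -> : j.+1%:R / m%:R - j%:R / m%:R = m%:R^-1 :> R.
  by rewrite -mulrBl -natr1 addrAC subrr add0r mul1r.
move=> /andP[h1 h2].
by rewrite /slope mulr_ge0//= mulrC -ler_pdivlMr// mul1r.
Qed.

Definition entropy_sum (G : R -> R) (m : nat) : R := \sum_(j < m) entropy (slope G m j).

(** Each binomial coefficient is estimated by [ln_bin_ge]. The rounding moves
    its proportion by at most 1 / L, which [entropy_modulus] absorbs, and ln L
    is bounded by e * L - ln e. *)
Lemma ln_layers_ge (G : R -> R) (m L : nat) (e : R) : is_dist G -> (0 < m)%N -> (0 < L)%N -> 0 < e ->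
  L%:R * entropy_sum G m - m%:R * (4 * e * L%:R + (ln ((1 + e) / e) + 2 - 2 * ln e))
   <= ln (\prod_(j < m) 'C(L, rounded G m L j.+1 - rounded G m L j))%:R.
Proof.
move=> dG m0 L0 e0; have L0' : 0 < L%:R :> R by rewrite ltr0n.
have bp j : (j < m)%N -> (0 < 'C(L, rounded G m L j.+1 - rounded G m L j))%N.
  by move=> jm; rewrite bin_gt0 rounded_incr_le.
rewrite natr_prod.
have [_ ->] : 0 < \prod_(j < m) ('C(L, rounded G m L j.+1 - rounded G m L j)%:R : R) /\
    ln (\prod_(j < m) ('C(L, rounded G m L j.+1 - rounded G m L j)%:R : R)) =
    \sum_(j < m) ln ('C(L, rounded G m L j.+1 - rounded G m L j)%:R : R).
  apply: (big_rec2 (fun u v => 0 < u /\ ln u = v)) => [|j u v _ [u0 <-]].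
    by rewrite ln1.
  by rewrite lnM ?mulr_gt0 ?posrE ?ltr0n ?bp.
rewrite /entropy_sum mulr_sumr.
rewrite [X in _ - X](_ : _ = \sum_(j < m) (4 * e * L%:R + (ln ((1 + e) / e) + 2 - 2 * ln e))); last first.
  by rewrite sumr_const card_ord mulr_natl.
rewrite -sumrB; apply: ler_sum => j _.
have jm := ltn_ord j.
set a := (rounded G m L j.+1 - rounded G m L j)%N.
have aL : (a <= L)%N by exact: rounded_incr_le.
have := ln_bin_ge R aL L0; apply: le_trans.
have a01 : 0 <= (a%:R / L%:R : R) <= 1 by rewrite divr_ge0//= ler_pdivrMr// mul1r ler_nat.
have s01 := slope01 dG m0 jm.
have := entropy_modulus s01 a01 e0.
have : `|a%:R / L%:R - slope G m j| <= L%:R^-1.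
  have := rounded_incr L dG m0 jm; rewrite -/a -/(slope G m j) => h.
  rewrite (_ : _ - _ = (a%:R - L%:R * slope G m j) / L%:R); last by field; lra.
  by rewrite normrM normfV (ger0_norm (ltW L0')) ler_piMl// invr_ge0 ltW.
have K0 : 0 <= ln ((1 + e) / e).
  by rewrite ln_ge0// ler_pdivlMr//; lra.
have := ln_sublinear_eps L0 e0.
move=> h1 h2 h3.
have h4 : L%:R * (`|a%:R / L%:R - slope G m j| * ln ((1 + e) / e)) <= ln ((1 + e) / e).
  rewrite mulrA ler_piMl//.
  by rewrite mulrC -ler_pdivlMr// mul1r.
have := ler_wpM2l (ltW L0') h3; rewrite !mulrDr; lra.
Qed.

Lemma close_to_layers (G1 G2 : R -> R) (m L n : nat) (de : R) : dist_pair G1 G2 ->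
  (0 < m)%N -> (0 < L)%N -> ((m + 1) * L <= n)%N ->
  4 * (n%:R - (m * L)%:R) + 3 <= n%:R * de ->
  ((\prod_(j < m) 'C(L, rounded G1 m L j.+1 - rounded G1 m L j)) *
  (\prod_(j < m) 'C(L, rounded G2 m L j.+1 - rounded G2 m L j)) <=
  #|[set s : 'S_n in Av321 n | `[< close_to G1 G2 de s >]]%SET|)%N.
Proof.
move=> [d1 d2 d11 d12] m0 L0 sz hde.
have n0 : (0 < n)%N by apply: leq_trans sz; rewrite muln_gt0 L0 addn1.
have n0' : 0 < n%:R :> R by rewrite ltr0n.
apply: (@card_layers_le n m L (rounded G1 m L) (rounded G2 m L) L0 sz).
- exact: rounded0.
- exact: rounded0.
- by move=> j; exact: rounded_mono.
- by move=> j; exact: rounded_mono.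
- by move=> j _; exact: rounded_le.
- by rewrite /rounded gridE// divff ?d11// pnatr_eq0 -lt0n.
move=> s U V sA hU hV sU sV; apply/asboolP.
have c1 (j : nat) : (j <= m)%N -> cnt (defpos s) ((j + 1) * L)%N = rounded G1 m L j.
  move=> jm; rewrite sU cnt_encode// (sum_layers _ _ hU)//.
    by move=> i; exact: rounded_mono.
  exact: rounded0.
have c2 (j : nat) : (j <= m)%N -> cnt (defval s) ((j + 0) * L)%N = rounded G2 m L j.
  move=> jm; rewrite sV cnt_encode// (sum_layers _ _ hV)//.
    by move=> i; exact: rounded_mono.
  exact: rounded0.
have [l1 l2 _ _] := set_mem (@pi_pair_calD R n s).
have fin (mu : unit_measure R) (G : R -> R) (C : {set 'I_n}) sft : le_leb mu -> is_dist G ->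
    (sft <= 1)%N -> (forall k, dist mu (k%:R / n%:R) = (cnt C k)%:R / n%:R) ->
    (forall j, (j <= m)%N -> cnt C ((j + sft) * L)%N = rounded G m L j) ->
    forall x, 0 <= x <= 1 -> `|dist mu x - G x| <= de.
  move=> lmu dG s1 hmu hC x x01.
  apply: (le_trans (@dist_close R n n0 mu G _ lmu dG _ x x01)); last first.
    rewrite ler_pdivrMr// mulrC; apply: le_trans hde.
    rewrite -[leRHS](_ : 4 * (n%:R - (m * L)%:R) + 1 + 2 = _)//; lra.
  move=> k kn; rewrite hmu.
  rewrite (_ : n%:R * ((cnt C k)%:R / n%:R) = (cnt C k)%:R); last by field; lra.
  exact: cnt_close hC _ kn.
move=> x x01; split.
- exact: (fin (pi1 R s) G1 (defpos s) 1%N l1 d1 isT (@dist_pi1 R n s) c1 x x01).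
- exact: (fin (pi2 R s) G2 (defval s) 0%N l2 d2 isT (@dist_pi2 R n s) c2 x x01).
Qed.

(** The layers have length n / (m + 1), the extra layer making room for the
    shift. *)
Lemma ln_close_to_ge (G1 G2 : R -> R) (m n : nat) (e de : R) : dist_pair G1 G2 ->
  (0 < m)%N -> 0 < e -> (m < n)%N ->
  4 * (n%:R / m.+1%:R + m%:R) + 3 <= n%:R * de ->
  exists2 L : nat, (n%:R - m%:R <= (m.+1%:R * L%:R : R) <= n%:R) &
  expR (L%:R * (entropy_sum G1 m + entropy_sum G2 m)
   - 2 * m%:R * (4 * e * L%:R + (ln ((1 + e) / e) + 2 - 2 * ln e))) <=
   #|[set s : 'S_n in Av321 n | `[< close_to G1 G2 de s >]]%SET|%:R.
Proof.
move=> dp m0 e0 mn hde; have [d1 d2 _ _] := dp.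
pose L := (n %/ m.+1)%N.
have L0 : (0 < L)%N by rewrite divn_gt0.
have sz : ((m + 1) * L <= n)%N by rewrite addn1 mulnC leq_trunc_div.
have nL : (n <= m.+1 * L + m)%N by have := ltn_ceil n (ltn0Sn m); rewrite -/L mulSn mulnC; lia.
have M0 : 0 < m.+1%:R :> R by rewrite ltr0n.
have szR : m.+1%:R * L%:R <= n%:R :> R by rewrite -natrM ler_nat -addn1.
have nLR : n%:R - m%:R <= m.+1%:R * L%:R :> R by rewrite lerBlDr -natrM -natrD ler_nat.
exists L; first by rewrite nLR szR.
have hde' : 4 * (n%:R - (m * L)%:R) + 3 <= n%:R * de.
  apply: le_trans hde; rewrite lerD2r ler_pM2l//.
  have : L%:R <= n%:R / m.+1%:R :> R by rewrite ler_pdivlMr// mulrC.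
  move: nLR; rewrite natrM -[m.+1%:R]natr1 mulrDl mul1r; move: (n%:R / _) => u; lra.
have := close_to_layers dp m0 L0 sz hde'; rewrite -(ler_nat R) => /(le_trans _); apply.
have P0 G : is_dist G -> (0 < \prod_(j < m) 'C(L, rounded G m L j.+1 - rounded G m L j))%N.
  move=> dG; rewrite prodn_gt0// => j; rewrite bin_gt0; apply: rounded_incr_le => //.
rewrite -[leRHS]lnK ?posrE ?ltr0n ?muln_gt0 ?P0//.
rewrite ler_expR natrM [leRHS]lnM ?posrE ?ltr0n ?P0//.
have := ln_layers_ge d1 m0 L0 e0; have := ln_layers_ge d2 m0 L0 e0.
move: (ln _%:R) (ln _%:R) => u v; move: (entropy_sum G1 m) (entropy_sum G2 m) => x y.
lra.
Qed.

(** The number m of layers is fixed first, so large that the shift by one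
    layer is negligible both for the distribution functions and in the
    exponent; then n tends to infinity, and the terms independent of n
    disappear. *)
Lemma close_to_eventually (G1 G2 : R -> R) (h e de : R) : dist_pair G1 G2 ->
  (forall m, (0 < m)%N -> m%:R * h <= entropy_sum G1 m + entropy_sum G2 m) ->
  0 < e -> 0 < de ->
  \forall n \near \oo,
  expR (n%:R * (h - e)) <= #|[set s : 'S_n in Av321 n | `[< close_to G1 G2 de s >]]%SET|%:R :> R.
Proof.
move=> dp hm e0 de0.
have X0 : 0 <= 4 * `|h| / e + 8 / de by rewrite addr_ge0// divr_ge0 ?mulr_ge0// ltW.
(* The first summand makes the term in h small in the exponent, the second one
   makes a layer short with respect to [de]. *)
have [m m0 mX] : exists2 m : nat, (0 < m)%N & 4 * `|h| / e + 8 / de <= m%:R.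
  by exists (Num.truncn (4 * `|h| / e + 8 / de)).+1 => //; have /andP[_ /ltW] := truncn_itv X0.
have M0 : 0 < m.+1%:R :> R by rewrite ltr0n.
have m0R : 0 < m%:R :> R by rewrite ltr0n.
have a0 : 0 <= 4 * `|h| / e by rewrite divr_ge0 ?mulr_ge0// ltW.
have b0 : 0 <= 8 / de by rewrite divr_ge0// ltW.
have hM : `|h| / m.+1%:R <= e / 4.
  rewrite ler_pdivrMr//; have : 4 * `|h| / e <= m%:R by lra.
  by rewrite ler_pdivrMr// -[m.+1%:R]natr1; lra.
have dM : 4 / m.+1%:R <= de / 2.
  rewrite ler_pdivrMr//; have : 8 / de <= m%:R by lra.
  by rewrite ler_pdivrMr// -[m.+1%:R]natr1; lra.
pose e' := e / 32; have e'0 : 0 < e' by rewrite /e'; lra.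
pose K := ln ((1 + e') / e') + 2 - 2 * ln e'.
near=> n.
have mn : (m < n)%N by near: n; exact: nbhs_infty_gt.
have n0 : 0 < n%:R :> R by rewrite ltr0n; apply: leq_trans mn.
have h1 : 2 * (4 * m%:R + 3) / de <= n%:R by near: n; exact: nbhs_infty_ger.
have h2 : 4 * (`|h| * m%:R + 2 * m%:R * K) / e <= n%:R by near: n; exact: nbhs_infty_ger.
rewrite ler_pdivrMr// in h1; rewrite ler_pdivrMr// in h2.
have hde : 4 * (n%:R / m.+1%:R + m%:R) + 3 <= n%:R * de.
  have := ler_wpM2l (ltW n0) dM.
  rewrite (_ : n%:R * (4 / m.+1%:R) = 4 * (n%:R / m.+1%:R)); last by field; lra.
  move: (n%:R / _) => u; lra.
have [L /andP[L1 L2]] := ln_close_to_ge dp m0 e'0 mn hde.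
apply: le_trans; rewrite ler_expR.
have L0 : 0 <= L%:R :> R by [].
have := ler_wpM2l L0 (hm m m0).
rewrite -/K; move: (entropy_sum G1 m + entropy_sum G2 m) => T hT.
have mL : m%:R * L%:R <= n%:R :> R.
  by apply: le_trans L2; rewrite ler_wpM2r// ler_nat.
have Ln : L%:R <= n%:R / m.+1%:R :> R by rewrite ler_pdivlMr// mulrC.
have hD : - (`|h| * (n%:R / m.+1%:R + m%:R)) <= (m%:R * L%:R - n%:R) * h.
  have D0 : 0 <= n%:R - m%:R * L%:R :> R by lra.
  have : (n%:R - m%:R * L%:R) * h <= `|h| * (n%:R / m.+1%:R + m%:R).
    apply: (le_trans (ler_norm _)); rewrite normrM (ger0_norm D0) mulrC ler_wpM2l//.
    have : n%:R - m%:R <= m%:R * L%:R + L%:R :> R by move: L1; rewrite -[m.+1%:R]natr1 mulrDl mul1r.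
    move: Ln; move: (n%:R / _) => u; lra.
  by have -> : (m%:R * L%:R - n%:R) * h = - ((n%:R - m%:R * L%:R) * h); [ring|rewrite lerN2].
have h3 : `|h| * (n%:R / m.+1%:R) <= n%:R * (e / 4).
  by rewrite mulrCA; apply: ler_wpM2l => //; exact: ltW.
have h4 : 8 * e' * (m%:R * L%:R) <= 8 * e' * n%:R by apply: ler_wpM2l => //; rewrite mulr_ge0// ltW.
have e'E : 8 * e' = e / 4 by rewrite /e'; lra.
move: hD; rewrite mulrDr => hD.
rewrite e'E in h4.
have -> : 2 * m%:R * (4 * e' * L%:R + K) = 8 * e' * (m%:R * L%:R) + 2 * m%:R * K by lra.
have ne0 : 0 <= n%:R * e by rewrite mulr_ge0// ltW.
rewrite e'E; clearbody K.
have hD2 : n%:R * h - `|h| * (n%:R / m.+1%:R) - `|h| * m%:R <= L%:R * T.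
  apply: le_trans hT; rewrite (_ : L%:R * (m%:R * h) = (m%:R * L%:R - n%:R) * h + n%:R * h); last by ring.
  rewrite -lerBlDr; apply: le_trans hD; rewrite le_eqVlt; apply/orP; left.
  by apply/eqP; ring.
rewrite (_ : n%:R * (h - e) = n%:R * h - n%:R * e); last by ring.
rewrite (_ : n%:R * (e / 4) = n%:R * e / 4) in h3; last by ring.
rewrite (_ : e / 4 * n%:R = n%:R * e / 4) in h4; last by ring.
move: hD2 h2 h3 h4 ne0.
move: (n%:R * h) (`|h| * _) (`|h| * _) (L%:R * T) (n%:R * e) (e / 4 * _) => x y z t u v.
by rewrite -mulrA; move: (m%:R * K) => w; lra.
Unshelve. all: by end_near. Qed.

End core.

(** * Jensen's inequality for the entropy of a density *)

Section Jensen_dens.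
Variable R : realType.
Notation leb := (@lebesgue_measure R).
Notation I01 := (`[0 : R, 1 : R]%classic).

Definition cell (m j : nat) : set R := `]j%:R / m%:R, j.+1%:R / m%:R]%classic.

Lemma cell_grid (m j : nat) : (j < m)%N ->
  [/\ 0 <= (j%:R / m%:R : R), j%:R / m%:R <= (j.+1%:R / m%:R : R) & j.+1%:R / m%:R <= (1 : R)].
Proof.
move=> jm; have m0 : 0 < m%:R :> R by rewrite ltr0n; apply: leq_ltn_trans jm.
split; first by rewrite divr_ge0.
  by apply: ler_wpM2r; rewrite ?invr_ge0 ?ler_nat.
by rewrite ler_pdivrMr// mul1r ler_nat.
Qed.

Lemma sub_cell (m j : nat) : (j < m)%N -> cell m j `<=` I01.
Proof.
move=> /cell_grid[h1 h2 h3] x; rewrite /cell /= !in_itv/= => /andP[h4 h5].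
by apply/andP; split; lra.
Qed.

Lemma leb_cell (m j : nat) : (j < m)%N -> fine (leb (cell m j)) = m%:R^-1.
Proof.
move=> jm; have m0 : 0 < m%:R :> R by rewrite ltr0n; apply: leq_ltn_trans jm.
rewrite /cell lebesgue_measure_itv/= lte_fin ltr_pM2r ?invr_gt0// ltr_nat ltnSn.
by rewrite -EFinD /= -mulrBl -natr1 addrAC subrr add0r mul1r.
Qed.

Lemma Rintegral_cells (u : R -> R) (m : nat) : (0 < m)%N ->
  leb.-integrable I01 (EFin \o u) ->
  (\int[leb]_(x in I01) u x)%R = \sum_(j < m) (\int[leb]_(x in cell m j) u x)%R.
Proof.
move=> m0 iu; have m0' : 0 < m%:R :> R by rewrite ltr0n.
suff H j : (j <= m)%N -> (\int[leb]_(x in `[0%R, (j%:R / m%:R)%R]) u x)%R =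
    \sum_(i < j) (\int[leb]_(x in cell m i) u x)%R.
  by rewrite -H// divff// gt_eqF.
elim: j => [_|j IH jm]; first by rewrite mul0r big_ord0 set_itv1 Rintegral_set1.
have [h1 h2 h3] := cell_grid jm.
rewrite big_ord_recr /= -IH; last exact: ltnW.
have E : `[0, j.+1%:R / m%:R]%classic = `[0, j%:R / m%:R]%classic `|` cell m j :> set R.
  by rewrite /cell -itv_bndbnd_setU// bnd_simp.
rewrite E Rintegral_setU//.
- exact: measurable_itv.
- apply: integrableS iu => //; first by apply: measurableU => //; exact: measurable_itv.
  move=> x [|/(sub_cell jm)//]; rewrite /= !in_itv/= => /andP[? ?]; apply/andP; split; lra.
- apply/disj_setPS => x []; rewrite /cell /= !in_itv/= => /andP[_ xa] /andP[ax _].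
  by have := lt_le_trans ax xa; rewrite ltxx.
Qed.

(** Jensen's inequality for the concave function [entropy]: by [entropy_le]
    the entropy of the density is below an affine function of the density,
    which by [entropy_ge] is almost tangent at the mean. *)
Lemma Jensen_cell (mu : unit_measure R) (m j : nat) : le_leb mu -> (j < m)%N ->
  m%:R * (\int[leb]_(x in cell m j) entropy (dens mu x))%R <= entropy (slope (dist mu) m j).
Proof.
move=> h jm; have m0 : (0 < m)%N by apply: leq_ltn_trans jm.
have m0' : 0 < m%:R :> R by rewrite ltr0n.
have s01 := slope01 (is_dist_dist h) m0 jm.
apply/ler_addgt0Pr => e e0; have e2 : 0 < e / 2 by lra.
have := entropy_ge s01 e2; set f := logit _ _ => hf.
have mc : measurable (cell m j : set (measurableTypeR R)) by exact: measurable_itv.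
have sub := sub_cell jm.
have id : leb.-integrable (cell m j) (EFin \o dens mu).
  apply: (@leb_integrable_bounded R _ 1) => //.
    by apply: measurable_funTS; exact: measurable_dens.
  by move=> x _; have /andP[d0 d1] := dens01 mu x; rewrite ger0_norm.
have ie : leb.-integrable (cell m j) (EFin \o (fun x => entropy (dens mu x))).
  by apply: integrableS (entropy_dens_integrable h) => //; exact: measurable_I01.
have ic (c : R) : leb.-integrable (cell m j) (EFin \o cst c).
  by apply: (@leb_integrable_bounded R _ `|c|).
have ifd : leb.-integrable (cell m j) (EFin \o (fun x => f * dens mu x)).
  by apply: eq_integrable (integrableZl mc f id) => // x _; rewrite /= EFinM.
have il : leb.-integrable (cell m j) (EFin \o (fun x => log1pexp f - f * dens mu x)).
  by have := integrableB mc (ic (log1pexp f)) ifd; exact.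
have : (\int[leb]_(x in cell m j) entropy (dens mu x))%R <=
    (\int[leb]_(x in cell m j) (log1pexp f - f * dens mu x))%R.
  by apply: le_Rintegral => // x _; have := entropy_le f (dens01 mu x); lra.
rewrite RintegralB//; last exact: ic.
rewrite Rintegral_cst// RintegralZl// leb_cell//.
have -> : (\int[leb]_(x in cell m j) dens mu x)%R = slope (dist mu) m j / m%:R.
  rewrite /Rintegral -dens_integral//; have [g1 g2 g3] := cell_grid jm.
  by rewrite /cell unit_measure_itv ?g1//= /slope; field; lra.
move=> /(ler_wpM2l (ltW m0')) /le_trans; apply.
have -> : m%:R * (log1pexp f / m%:R - f * (slope (dist mu) m j / m%:R)) =
  log1pexp f - slope (dist mu) m j * f by field; lra.
lra.
Qed.

Lemma meanent_le_entropy_sum (mu : unit_measure R) (m : nat) : le_leb mu -> (0 < m)%N ->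
  m%:R * meanent mu <= entropy_sum (dist mu) m.
Proof.
move=> h m0; rewrite /meanent (Rintegral_cells m0 (entropy_dens_integrable h)).
by rewrite mulr_sumr; apply: ler_sum => j _; exact: Jensen_cell.
Qed.

End Jensen_dens.

(** * Counting in open and closed sets *)

Section neighborhoods.
Variable R : realType.

(** By [cvg_calD], the pairs with distribution functions uniformly close to
    those of p converge to p, hence end up in O. *)
Lemma open_close_to (O : set (@calD R)) (p : @calD R) : open O -> O p ->
  exists2 de : R, 0 < de & forall n (s : 'S_n),
    close_to (dist (val p).1) (dist (val p).2) de s -> O (pi_pair R s).
Proof.
move=> oO Op.
pose B (de : R) : set (@calD R) := [set q | forall x, 0 <= x <= 1 ->
  `|dist (val q).1 x - dist (val p).1 x| <= de /\ `|dist (val q).2 x - dist (val p).2 x| <= de].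
(* The sets [B de] form a filter base that converges to p. *)
pose F := filter_from [set de : R | 0 < de] B.
have FF : Filter F.
  apply: filter_from_filter; first by exists 1; exact: ltr01.
  move=> a b a0 b0; exists (Num.min a b); first by rewrite /= lt_min a0.
  move=> q Bq; split => x x01; have [] := Bq x x01;
  by rewrite !le_min => /andP[? ?] /andP[? ?].
have : F --> p.
  by apply: cvg_calD => x x01; apply/cvgrPdist_le => e e0;
    exists e => // q Bq; rewrite distrC; have [] := Bq x x01.
move=> /(_ O (open_nbhs_nbhs (conj oO Op))) [de de0 BO].
by exists de => // n s hs; apply: BO.
Qed.

Definition count (n : nat) (S : set (@calD R)) : nat :=
  #|[set s : 'S_n in Av321 n | `[< S (pi_pair R s) >]]%SET|.

Lemma count_open_ge (O : set (@calD R)) (p : @calD R) (e : R) : open O -> O p -> 0 < e ->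
  \forall n \near \oo,
   expR (n%:R * (meanent (val p).1 + meanent (val p).2 - e)) <= (count n O)%:R.
Proof.
move=> oO Op e0; have [de de0 hde] := open_close_to oO Op.
have [h1 h2 h3 h4] := set_mem (valP p).
have dp : dist_pair (dist (val p).1) (dist (val p).2).
  split; [exact: is_dist_dist|exact: is_dist_dist| |].
    by rewrite /dist h3.
  by move=> x x01; rewrite -lee_fin !distE; apply: h4; rewrite in_itv.
have hm (m : nat) : (0 < m)%N -> m%:R * (meanent (val p).1 + meanent (val p).2) <=
    entropy_sum (dist (val p).1) m + entropy_sum (dist (val p).2) m.
  by move=> m0; rewrite mulrDr lerD// meanent_le_entropy_sum.
have := close_to_eventually dp hm e0 de0; apply: filterS => n /le_trans; apply.
rewrite ler_nat; apply: subset_leq_card; apply/fintype.subsetP => s.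
by rewrite !finset.in_set => /andP[-> /asboolP/hde]; move/asboolP.
Qed.

(** The density 1/2 maximises the entropy, so the permutations close to this
    pair of densities are already numerous enough. *)
Lemma card_Av321_ge (e : R) : 0 < e ->
  \forall n \near \oo, expR (n%:R * (2 * ln 2 - e)) <= #|Av321 n|%:R :> R.
Proof.
move=> e0; pose G (x : R) := x / 2.
have dG : is_dist G.
  by split; [rewrite /G mul0r|move=> a b a0 ab b1; rewrite /G; apply/andP; split; lra].
have dp : dist_pair G G by split.
have hm (m : nat) : (0 < m)%N -> m%:R * (2 * ln 2) <= entropy_sum G m + entropy_sum G m.
  move=> m0; have m0' : 0 < m%:R :> R by rewrite ltr0n.
  have -> : entropy_sum G m = m%:R * ln 2.
    rewrite /entropy_sum (eq_bigr (fun=> ln 2)); first by rewrite sumr_const card_ord mulr_natl.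
    move=> j _; rewrite -entropy_half; congr entropy.
    have E : j.+1%:R = j%:R + 1 :> R by rewrite natr1.
    by rewrite /slope /G E; field; lra.
  lra.
have := close_to_eventually dp hm e0 ltr01; apply: filterS => n /le_trans; apply.
rewrite ler_nat; apply: subset_leq_card; apply/fintype.subsetP => s.
by rewrite finset.in_set => /andP[].
Qed.

(** The functional [Psi 0 0] vanishes identically, so [card_Psi_le] at a = 0
    counts all 321-avoiding permutations. *)
Lemma card_Av321_le (n : nat) : #|Av321 n|%:R <= expR (n%:R * (2 * ln 2)) :> R.
Proof.
have c0 : {within `[(0 : R), 1], continuous (fun=> 0 : R)}.
  by apply: continuous_subspaceT => x; exact: cvg_cst.
pose z : test_fun R := exist _ (fun=> 0) c0.
have := @card_Psi_le R n z z 0; rewrite subr0; apply: le_trans; rewrite ler_nat.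
apply: subset_leq_card; apply/fintype.subsetP => s sA; rewrite finset.in_set sA /=.
have J0 (mu : unit_measure R) : Jdual mu (sval z) = - ln 2.
  rewrite /Jdual /= /log1pexp expR0 Rintegral_I01_cst Rintegral_cst ?mul0r ?sub0r//.
by rewrite /Psi !J0; lra.
Qed.

(** F is compact, hence covered by finitely many of the open sets where
    [a < Psi f g], to each of which [card_Psi_le] applies; K is the number of
    these sets. *)
Lemma count_closed_le (F : set (@calD R)) (a : R) : closed F ->
  (forall q, F q -> (a%:E < H321 q)%E) ->
  exists K : nat, forall n, (count n F)%:R <= K%:R * expR (n%:R * (2 * ln 2 - a)).
Proof.
move=> cF Fa.
pose cov (l : seq (test_fun R * test_fun R)) (q : @calD R) := has (fun fg => a < Psi fg.1 fg.2 q) l.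
(* Finite lists of pairs, filtered by inclusion of the open sets they cover. *)
pose G := filter_from [set: seq (test_fun R * test_fun R)]
  (fun l0 => [set l | forall q, cov l0 q -> cov l q]).
have FG : Filter G.
  apply: filter_from_filter; first by exists [::].
  move=> l1 l2 _ _; exists (l1 ++ l2) => // l hl; split => q hq; apply: hl;
  by rewrite /cov has_cat -/(cov l1 q) -/(cov l2 q) hq ?orbT.
have /compact_near_coveringP := subclosed_compact cF (@compact_calD R) (@subsetT _ F).
move=> /(_ _ G (fun l q => cov l q) FG) [].
  move=> q Fq; have [f [g afg]] := Psi_approx (Fa q Fq).
  exists ([set q' | a < Psi f g q'], [set l | forall q', cov [:: (f, g)] q' -> cov l q']); first split.
  - exact: (@continuous_Psi R f g q [set r | a < r] (open_nbhs_nbhs (conj (@open_gt _ a) afg))).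
  - by exists [:: (f, g)].
  - by move=> [q' l] [h1 h2]; apply: h2; rewrite /cov /= h1.
move=> l _ /(_ l (fun q h => h)) Fl; exists (size l) => n.
have : (count n F <= \sum_(fg <- l) #|[set s in Av321 n | (a <= Psi fg.1 fg.2 (pi_pair R s))%R]%SET|)%N.
  apply: (@leq_trans #|[set s in Av321 n | cov l (pi_pair R s)]%SET|).
    apply: subset_leq_card; apply/fintype.subsetP => s; rewrite !finset.in_set.
    by move=> /andP[-> /asboolP/Fl].
  elim: l {Fl} => [|fg l IH].
    by rewrite big_nil leqn0 cards_eq0; apply/eqP/setP => s; rewrite !finset.in_set andbF.
  rewrite big_cons; apply: leq_trans (leq_add (leqnn _) IH).
  apply: leq_trans (leq_card_setU _ _); apply: subset_leq_card; apply/fintype.subsetP => s.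
  by rewrite !finset.in_set /cov /= => /andP[-> /orP[/ltW->|->]]; rewrite ?orbT.
rewrite -(ler_nat R) => /le_trans; apply.
rewrite natr_sum.
apply: (le_trans (ler_sum _ (fun fg _ => card_Psi_le n fg.1 fg.2 a))).
by rewrite big_const_seq count_predT iter_addr_0 -[leLHS]mulr_natl.
Qed.

End neighborhoods.

(** * Probabilities as ratios of cardinals *)

Section uniform_law.
Context (R : realType) (d : measure_display) (Omega : measurableType d)
  (P : probability Omega R) (T : finType) (X : Omega -> T) (A : {set T}).
Hypothesis uX : uniform_on P X A.

(** By induction on the list of values, adding one atom at a time. *)
Lemma uniform_preimage_seq (s : seq T) : uniq s ->
  measurable (X @^-1` [set` s]) /\
  P (X @^-1` [set` s]) = ((#|[set t in A | t \in s]%SET|)%:R / #|A|%:R)%:E.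
Proof.
elim: s => [_|t s IH /= /andP[ts us]].
  have -> : X @^-1` [set` [::]] = set0 by apply/seteqP; split.
  split=> //; rewrite measure0 (_ : [set _ in _ | _]%SET = finset.set0) ?cards0 ?mul0r//.
  by apply/setP => x; rewrite !finset.in_set andbF.
have [ms Ps] := IH us; have [mt Pt] := uX t.
have -> : X @^-1` [set` t :: s] = X @^-1` [set t] `|` X @^-1` [set` s].
  apply/seteqP; split => w /=; rewrite in_cons.
    by move=> /orP[/eqP|]; [left|right].
  by move=> [->|->]; rewrite ?eqxx ?orbT.
split; first exact: measurableU.
rewrite measureU//; last first.
  by apply/seteqP; split=> w //= [->]; rewrite (negbTE ts).
rewrite [X in (X + _)%E]Pt [X in (_ + X)%E]Ps -EFinD; congr EFin.
rewrite (cardsD1 t [set x in A | x \in t :: s]%SET) finset.in_set mem_head andbT natrD mulrDl; congr (_ + _).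
  by case: (t \in A); rewrite ?div1r ?mul0r.
congr (_%:R / _); apply: eq_card => x; rewrite !finset.in_set in_cons.
by rewrite finset.in_set1; have [->|] := eqVneq x t; rewrite ?(negbTE ts) ?andbF.
Qed.

Lemma uniform_preimage (S : set T) :
  measurable (X @^-1` S) /\
  P (X @^-1` S) = ((#|[set t in A | `[< S t >]]%SET|)%:R / #|A|%:R)%:E.
Proof.
have := uniform_preimage_seq (enum_uniq [pred t | `[< S t >]]).
have -> : [set` enum [pred t | `[< S t >]]] = S.
  by apply/seteqP; split => t; rewrite /= mem_enum => h; apply/asboolP.
have -> // : [set t in A | t \in enum [pred t | `[< S t >]]]%SET = [set t in A | `[< S t >]]%SET.
by apply/setP => t; rewrite !finset.in_set mem_enum inE.
Qed.

End uniform_law.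

(** * Exponential rates *)

Section exponential_rates.
Variable R : realType.

Lemma lne_rate_le (N q b : R) : 0 < N -> 0 <= q -> q <= expR (N * b) ->
  (N^-1%:E * lne q%:E <= b%:E)%E.
Proof.
move=> N0 q0 qb.
have h : (lne q%:E <= (N * b)%:E)%E.
  rewrite -[X in (_ <= X%:E)%E]expRK -lne_EFin ?expR_gt0// lee_lne ?lee_fin//.
    by rewrite in_itv/= lee_fin q0 leey.
  by rewrite in_itv/= lee_fin expR_ge0 leey.
apply: (@le_trans _ _ (N^-1%:E * (N * b)%:E)%E).
  by apply: lee_wpmul2l h; rewrite lee_fin invr_ge0 ltW.
by rewrite -EFinM mulKf// gt_eqF.
Qed.

Lemma lne_rate_ge (N q b : R) : 0 < N -> expR (N * b) <= q ->
  (b%:E <= N^-1%:E * lne q%:E)%E.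
Proof.
move=> N0 qb; have q0 : 0 < q by apply: lt_le_trans qb; exact: expR_gt0.
rewrite lne_EFin// -EFinM lee_fin mulrC ler_pdivlMr// mulrC.
by rewrite -[leLHS]expRK ler_ln// posrE expR_gt0.
Qed.

Lemma limn_esup_le (u : (\bar R)^nat) (c : \bar R) :
  (\forall n \near \oo, (u n <= c)%E) -> (limn_esup u <= c)%E.
Proof.
move=> h; apply: (@le_trans _ _ (ereal_sup (u @` [set n | (u n <= c)%E]))).
  by apply: ereal_inf_lbound; exists [set n | (u n <= c)%E].
by apply: ge_ereal_sup => _ [n /= hn <-].
Qed.

Lemma limn_einf_ge (u : (\bar R)^nat) (c : \bar R) :
  (\forall n \near \oo, (c <= u n)%E) -> (c <= limn_einf u)%E.
Proof.
move=> h; rewrite -leeN2 -limn_esupN; apply: limn_esup_le.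
by apply: filterS h => n; rewrite /= leeN2.
Qed.

Lemma lee_real_lt (x y : \bar R) : (forall c : R, (c%:E < x)%E -> (c%:E <= y)%E) -> (x <= y)%E.
Proof.
move=> h; rewrite leNgt; apply/negP => yx.
case: y yx h => [y| |] + h; last first.
- case: x h => [x| |]//= h _.
    by have := h (x - 1); rewrite lte_fin ltrBlDr ltrDl ltr01 => /(_ isT).
  by have := h 0 (ltry _).
- by rewrite ltNge leey.
case: x h => [x| |]//= h.
  rewrite lte_fin => yx; have := h ((x + y) / 2); rewrite lte_fin lee_fin => h1.
  have : (x + y) / 2 <= y by apply: h1; lra.
  lra.
by move=> _; have := h (y + 1) (ltry _); rewrite lee_fin; lra.
Qed.

Lemma near_shift (Q : nat -> Prop) : (\forall n \near \oo, Q n) -> \forall n \near \oo, Q n.+1.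
Proof. by move=> [k _ hk]; exists k => // n /= kn; apply: hk => /=; apply: leqW. Qed.

Lemma near_cst_le_expR (K e : R) : 0 < e -> \forall n \near \oo, K <= expR (n%:R * e).
Proof.
move=> e0; have := nbhs_infty_ger (K / e); apply: filterS => n.
rewrite ler_pdivrMr// => /le_trans; apply.
by apply: le_trans (expR_ge1Dx _); rewrite lerDr.
Qed.

End exponential_rates.

(** * The large deviation principle *)

Section ldp_bounds.
Variable R : realType.
Notation prob n S := ((count n S)%:R / #|Av321 n|%:R : R).

(** The constant of [count_closed_le] and the lower bound [card_Av321_ge] on
    the denominator cost e / 2 each in the exponent. *)
Lemma prob_closed_le (F : set (@calD R)) (a e : R) : closed F ->
  (forall q, F q -> (a%:E < H321 q)%E) -> 0 < e ->
  \forall n \near \oo, prob n F <= expR (n%:R * (- a + e)).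
Proof.
move=> cF Fa e0; have e2 : 0 < e / 2 by lra.
have [K hK] := count_closed_le cF Fa.
have hA := card_Av321_ge e2; have hE := near_cst_le_expR K%:R e2.
near=> n.
have A : expR (n%:R * (2 * ln 2 - e / 2)) <= #|Av321 n|%:R :> R by near: n.
have E : K%:R <= expR (n%:R * (e / 2)) :> R by near: n.
have A0 : 0 < #|Av321 n|%:R :> R by apply: lt_le_trans A; exact: expR_gt0.
rewrite ler_pdivrMr//; apply: le_trans (hK n) _.
apply: (@le_trans _ _ (expR (n%:R * (- a + e)) * expR (n%:R * (2 * ln 2 - e / 2)))).
  apply: (@le_trans _ _ (expR (n%:R * (e / 2)) * expR (n%:R * (2 * ln 2 - a)))).
    by apply: ler_wpM2r => //; exact: expR_ge0.
  rewrite -!expRD -!mulrDr ler_expR; apply: ler_wpM2l => //.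
  by move: (ln 2) => l2; lra.
by apply: ler_wpM2l => //; exact: expR_ge0.
Unshelve. all: by end_near. Qed.

Lemma prob_open_ge (O : set (@calD R)) (p : @calD R) (e : R) : open O -> O p -> 0 < e ->
  \forall n \near \oo,
    expR (n%:R * (meanent (val p).1 + meanent (val p).2 - 2 * ln 2 - e)) <= prob n O.
Proof.
move=> oO Op e0; have h := count_open_ge oO Op e0.
near=> n.
have C : expR (n%:R * (meanent (val p).1 + meanent (val p).2 - e)) <= (count n O)%:R by near: n.
have C0 : 0 < (count n O)%:R :> R by apply: lt_le_trans C; exact: expR_gt0.
have A0 : 0 < #|Av321 n|%:R :> R.
  apply: lt_le_trans C0 _; rewrite ler_nat; apply: subset_leq_card.
  by apply/fintype.subsetP => s; rewrite finset.in_set => /andP[].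
rewrite ler_pdivlMr//.
apply: le_trans C; apply: (@le_trans _ _
  (expR (n%:R * (meanent (val p).1 + meanent (val p).2 - 2 * ln 2 - e)) * expR (n%:R * (2 * ln 2)))).
  by apply: ler_wpM2l (card_Av321_le R n); exact: expR_ge0.
by rewrite -expRD -mulrDr ler_expR; apply: ler_wpM2l => //; move: (meanent _) (meanent _) (ln 2) => u v w; lra.
Unshelve. all: by end_near. Qed.

End ldp_bounds.

(* The index n stands for the size n.+1, so that all sizes >= 1 are covered. *)
Theorem proposition5 (R : realType) (d : nat -> measure_display)
    (Omega : forall n : nat, measurableType (d n))
    (P : forall n : nat, probability (Omega n) R)
    (sigma : forall n : nat, Omega n -> 'S_n.+1)
    (sigma_unif : forall n : nat,
      uniform_on (P n) (sigma n) (Av321 n.+1)) :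
  ldp P (fun (n : nat) (w : Omega n) => pi_pair R (sigma n w))
    (fun n : nat => n.+1%:R : R) (@H321 R).
Proof.
have law n (S : set (@calD R)) := uniform_preimage (sigma_unif n) ((fun s => pi_pair R s) @^-1` S).
have PE n (S : set (@calD R)) : P n ((fun w => pi_pair R (sigma n w)) @^-1` S) =
    ((count n.+1 S)%:R / #|Av321 n.+1|%:R)%:E := (law n S).2.
split.
- by move=> n B _; exact: (law n B).1.
- by apply/cvgryPge => A; have := near_shift (nbhs_infty_ger A); exact.
- by split; [exact: H321_ge0 | exact: H321_lsc].
- move=> F cF; rewrite leeNr; apply: lee_real_lt => a aF.
  rewrite leeNr; apply/lee_addgt0Pr => e e0; rewrite -EFinN -EFinD.
  apply: limn_esup_le.
  have Fa q : F q -> (a%:E < H321 q)%E.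
    by move=> Fq; apply: lt_le_trans aF _; apply: ereal_inf_lbound; exists q.
  have := near_shift (prob_closed_le cF Fa e0); apply: filterS => n h.
  by rewrite PE; apply: lne_rate_le h; rewrite ?ltr0n// divr_ge0.
- move=> O oO; rewrite leeNl; apply/ereal_infP => _ [p Op <-].
  rewrite H321_meanent leeNl; apply/lee_addgt0Pr => e e0.
  rewrite -leeBlDr// -EFinN -EFinB; apply: limn_einf_ge.
  have := near_shift (prob_open_ge oO Op e0); apply: filterS => n h.
  rewrite PE; apply: lne_rate_ge; first by rewrite ltr0n.
  by apply: le_trans h; rewrite ler_expR; apply: ler_wpM2l => //;
    move: (meanent _) (meanent _) (ln 2) => u v w; lra.
Qed.
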